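(* Let $(M_N)$ be probability measures on $\mathbb Y(N)$ whose Jack generating functions $F_N(\mathbf p;\theta)$ satisfy Assumption A, and let $F_N(x_1,\dots,x_N;\theta)=\sum_{\lambda\in\mathbb Y(N)}M_N(\lambda)J_\lambda(x_1,\dots,x_N;\theta)/J_\lambda(1^N;\theta)$ be the $N$-variable version. Write $\Psi_N=\ln F_N(x_1,\dots,x_N;\theta)$ and evaluate derivatives at $x_1=\dots=x_N=1$. Then: (a) Assumption L holds (with constants $\mathfrak c_k$) if and only if: for every index $i$ and $k\ge1$, $\lim_N\frac1N\partial_i^k\Psi_N|_{1^N}=\mathfrak c_k$; and for every $r\ge2$ and indices $i_1,\dots,i_r$ with at least two distinct, $\lim_N\frac1N\partial_{i_1}\cdots\partial_{i_r}\Psi_N|_{1^N}=0$. (b) Assumption C holds (with constants $\mathfrak c_k,\mathfrak d_{k,l}$) if and only if: for every $i$ and $k\ge1$, $\lim_N\frac1N\partial_i^k\Psi_N|_{1^N}=\mathfrak c_k$; for distinct $i,j$ and $k,l\ge1$, $\lim_N\partial_i^k\partial_j^l\Psi_N|_{1^N}=\mathfrak d_{k,l}$; and for $r\ge3$ and indices $i_1,\dots,i_r$ with at least three distinct, $\lim_N\partial_{i_1}\cdots\partial_{i_r}\Psi_N|_{1^N}=0$.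
   Context: Fix $\theta>0$. Young diagrams, $\ell(\lambda)$, $|\lambda|$, $\mathbb Y(N)$ (at most $N$ nonzero parts), $\mathbb Y$. Symmetric functions $=\mathbb R[p_1,p_2,\dots]$, $p_n=\sum_ix_i^n$, $p_\lambda=\prod p_{\lambda_i}$. $J_\lambda(\mathbf p;\theta)$ = Jack symmetric function (orthogonal for $\langle p_\lambda,p_\mu\rangle=\delta_{\lambda\mu}z_\lambda\theta^{-\ell(\lambda)}$, triangular in the monomial basis, leading term $x_1^{\lambda_1}\cdots x_\ell^{\lambda_\ell}$); $J_\lambda(x_1,\dots,x_N;\theta)$ its specialization $x_{N+1}=\dots=0$. ''$\mathbf p=1^N$'': $p_n=N$ for all $n$. $F_N(\mathbf p;\theta)=\sum_{\lambda\in\mathbb Y(N)}M_N(\lambda)J_\lambda(\mathbf p;\theta)/J_\lambda(1^N;\theta)=\sum_{\lambda\in\mathbb Y}a_{M_N}(\lambda)p_\lambda$. Assumption A: there is $\varepsilon>0$ with $\sum_\lambda|a_{M_N}(\lambda)|N^{\ell(\lambda)}|x|^{|\lambda|}<\infty$ for all $N$, $|x|<1+\varepsilon$. Assumption L: (1) $\lim_N\frac1N\sum_{i\ge1}k!\binom ik\partial_{p_i}\ln F_N|_{1^N}=\mathfrak c_k$ for each $k\ge1$; (2) for $r\ge2$, $k_1,\dots,k_r\ge1$: $\lim_N\frac1N\sum_{i_1,\dots,i_r\ge1}\prod_j\binom{i_j}{k_j}\partial_{p_{i_1}}\cdots\partial_{p_{i_r}}\ln F_N|_{1^N}=0$. Assumption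 C: (1) as L(1); (2) $\lim_N\sum_{i,j\ge1}k!l!\binom ik\binom jl\partial_{p_i}\partial_{p_j}\ln F_N|_{1^N}=\mathfrak d_{k,l}$ for $k,l\ge1$; (3) for $r\ge3$: $\lim_N\sum_{i_1,\dots,i_r\ge1}\prod_j\binom{i_j}{k_j}\partial_{p_{i_1}}\cdots\partial_{p_{i_r}}\ln F_N|_{1^N}=0$. *)

(* Defs.v *)
From Stdlib Require Import Reals List Arith ClassicalEpsilon.
Import ListNotations.
Open Scope R_scope.

Definition sumR {A : Type} (l : list A) (f : A -> R) : R :=
  fold_right (fun a s => f a + s) 0 l.
Definition prodR {A : Type} (l : list A) (f : A -> R) : R :=
  fold_right (fun a s => f a * s) 1 l.

(* A Young diagram is a nonincreasing list of positive parts. *)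
Definition psize (l : list nat) : nat := fold_right Nat.add 0%nat l.

Fixpoint pt_aux (fuel m n : nat) : list (list nat) :=
  match n with
  | O => [[]]
  | S _ =>
    match fuel with
    | O => []
    | S f => flat_map (fun k => map (cons k) (pt_aux f k (n - k)))
                      (seq 1 (Nat.min m n))
    end
  end.

Definition parts (n : nat) : list (list nat) := pt_aux n n n.

Definition YN (N n : nat) : list (list nat) :=
  filter (fun l => Nat.leb (length l) N) (parts n).

Definition mult (i : nat) (l : list nat) : nat := count_occ Nat.eq_dec l i.
Definition zee (l : list nat) : R :=
  prodR (seq 1 (psize l)) (fun i => INR i ^ mult i l * INR (fact (mult i l))).

Fixpoint allfuns (k m : nat) : list (list nat) :=
  match k with
  | O => [[]]
  | S k' => flat_map (fun j => map (cons j) (allfuns k' m)) (seq 0 m)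
  end.

(* coefficient of x^nu (i.e. of m_nu) in p_mu = prod_i p_{mu_i} *)
Definition pcoefm (mu nu : list nat) : R :=
  INR (length (filter
    (fun f => forallb
       (fun j => Nat.eqb
          (fold_right Nat.add 0%nat
             (map (fun i => if Nat.eqb (nth i f 0%nat) j then nth i mu 0%nat else 0%nat)
                  (seq 0 (length mu))))
          (nth j nu 0%nat))
       (seq 0 (length nu)))
    (allfuns (length mu) (length nu)))).

Definition firstsum (k : nat) (l : list nat) : nat := psize (firstn k l).
Definition dom_le (nu lam : list nat) : Prop :=
  forall k, (firstsum k nu <= firstsum k lam)%nat.

(* A family of symmetric functions J_lambda = sum_{mu |- |lambda|} J lambda mu * p_mu.
   Coefficient of m_nu in J_lambda: *)
Definition mcoef (J : list nat -> list nat -> R) (lam nu : list nat) : R :=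
  sumR (parts (psize lam)) (fun mu => J lam mu * pcoefm mu nu).

(* J is the family of Jack symmetric functions with parameter theta:
   orthogonal for <p_l,p_m> = delta z_l theta^{-l(l)}, and
   J_lambda = m_lambda + (lower terms in dominance order). *)
Definition IsJack (theta : R) (J : list nat -> list nat -> R) : Prop :=
  (forall n lam nu, In lam (parts n) -> In nu (parts n) -> lam <> nu ->
     sumR (parts n) (fun mu => J lam mu * J nu mu * (zee mu / theta ^ length mu)) = 0)
  /\
  (forall n lam, In lam (parts n) ->
     mcoef J lam lam = 1 /\
     (forall nu, In nu (parts n) -> nu <> lam -> ~ dom_le nu lam -> mcoef J lam nu = 0)).

Definition pprod (mu : list nat) (p : nat -> R) : R := prodR mu (fun m => p m).
Definition Jp (J : list nat -> list nat -> R) (lam : list nat) (p : nat -> R) : R :=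
  sumR (parts (psize lam)) (fun mu => J lam mu * pprod mu p).
(* J_lambda(1^N) : p_n = N for all n *)
Definition pone (N : nat) : nat -> R := fun _ => INR N.
Definition J1 (J : list nat -> list nat -> R) (lam : list nat) (N : nat) : R :=
  Jp J lam (pone N).

Definition Series (u : nat -> R) : R :=
  epsilon (inhabits 0) (fun l => infinite_sum u l).

Definition IsProbY (M : list nat -> R) (N : nat) : Prop :=
  (forall n lam, In lam (YN N n) -> 0 <= M lam) /\
  infinite_sum (fun n => sumR (YN N n) M) 1.

Definition FN (J : list nat -> list nat -> R) (M : nat -> list nat -> R) (N : nat)
  (p : nat -> R) : R :=
  Series (fun n => sumR (YN N n) (fun lam => M N lam * Jp J lam p / J1 J lam N)).

(* coefficient a_{M_N}(mu) of p_mu in F_N *)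
Definition aM (J : list nat -> list nat -> R) (M : nat -> list nat -> R) (N : nat)
  (mu : list nat) : R :=
  sumR (YN N (psize mu)) (fun lam => M N lam * J lam mu / J1 J lam N).

Definition AssumptionA (J : list nat -> list nat -> R) (M : nat -> list nat -> R) : Prop :=
  exists eps, 0 < eps /\
    forall (N : nat) (x : R), Rabs x < 1 + eps ->
      exists l, infinite_sum
        (fun n => sumR (parts n)
           (fun mu => Rabs (aM J M N mu) * INR N ^ length mu * Rabs x ^ n)) l.

Definition Dpt (f : R -> R) (t : R) : R :=
  epsilon (inhabits 0) (fun l => derivable_pt_lim f t l).
Definition upd (p : nat -> R) (i : nat) (t : R) : nat -> R :=
  fun j => if Nat.eqb j i then t else p j.
Definition pd (i : nat) (g : (nat -> R) -> R) : (nat -> R) -> R :=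
  fun p => Dpt (fun t => g (upd p i t)) (p i).
Definition pds (is : list nat) (g : (nat -> R) -> R) : (nat -> R) -> R :=
  fold_right pd g is.

Definition lnF (J : list nat -> list nat -> R) (M : nat -> list nat -> R) (N : nat) :
  (nat -> R) -> R := fun p => ln (FN J M N p).

Definition pxs (N : nat) (x : nat -> R) : nat -> R :=
  fun n => sumR (seq 1 N) (fun i => x i ^ n).
Definition FxN (J : list nat -> list nat -> R) (M : nat -> list nat -> R) (N : nat)
  (x : nat -> R) : R := FN J M N (pxs N x).
Definition Psi (J : list nat -> list nat -> R) (M : nat -> list nat -> R) (N : nat) :
  (nat -> R) -> R := fun x => ln (FxN J M N x).
Definition xone : nat -> R := fun _ => 1.

Definition binomR (i k : nat) : R := if Nat.leb k i then Binomial.C i k else 0.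

Fixpoint msum (r : nat) (f : list nat -> R) : R :=
  match r with
  | O => f []
  | S r' => Series (fun j => msum r' (fun is => f (S j :: is)))
  end.

Definition prodbinom (is ks : list nat) : R :=
  prodR (combine is ks) (fun ik => binomR (fst ik) (snd ik)).

Definition AssumptionL1 J M (cc : nat -> R) : Prop :=
  forall k, (1 <= k)%nat ->
    Un_cv (fun N => / INR N *
      Series (fun j => INR (fact k) * binomR (S j) k * pds [S j] (lnF J M N) (pone N)))
      (cc k).

Definition AssumptionL J M (cc : nat -> R) : Prop :=
  AssumptionL1 J M cc /\
  (forall ks : list nat, (2 <= length ks)%nat -> Forall (fun k => (1 <= k)%nat) ks ->
    Un_cv (fun N => / INR N *
      msum (length ks) (fun is => prodbinom is ks * pds is (lnF J M N) (pone N))) 0).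

Definition AssumptionC J M (cc : nat -> R) (d : nat -> nat -> R) : Prop :=
  AssumptionL1 J M cc /\
  (forall k l, (1 <= k)%nat -> (1 <= l)%nat ->
    Un_cv (fun N =>
      msum 2 (fun is => INR (fact k) * INR (fact l) * binomR (nth 0 is 0%nat) k
                         * binomR (nth 1 is 0%nat) l * pds is (lnF J M N) (pone N)))
      (d k l)) /\
  (forall ks : list nat, (3 <= length ks)%nat -> Forall (fun k => (1 <= k)%nat) ks ->
    Un_cv (fun N =>
      msum (length ks) (fun is => prodbinom is ks * pds is (lnF J M N) (pone N))) 0).

Definition CondX1 J M (cc : nat -> R) : Prop :=
  forall i k, (1 <= i)%nat -> (1 <= k)%nat ->
    Un_cv (fun N => / INR N * pds (repeat i k) (Psi J M N) xone) (cc k).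

Definition CondLx J M (cc : nat -> R) : Prop :=
  CondX1 J M cc /\
  (forall is : list nat, (2 <= length is)%nat -> Forall (fun i => (1 <= i)%nat) is ->
    (exists a b, In a is /\ In b is /\ a <> b) ->
    Un_cv (fun N => / INR N * pds is (Psi J M N) xone) 0).

Definition CondCx J M (cc : nat -> R) (d : nat -> nat -> R) : Prop :=
  CondX1 J M cc /\
  (forall i j k l, (1 <= i)%nat -> (1 <= j)%nat -> i <> j -> (1 <= k)%nat -> (1 <= l)%nat ->
    Un_cv (fun N => pds (repeat i k ++ repeat j l) (Psi J M N) xone) (d k l)) /\
  (forall is : list nat, (3 <= length is)%nat -> Forall (fun i => (1 <= i)%nat) is ->
    (exists a b e, In a is /\ In b is /\ In e is /\ a <> b /\ a <> e /\ b <> e) ->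
    Un_cv (fun N => pds is (Psi J M N) xone) 0).

(* Main.v *)
Require Import Defs.
From Stdlib Require Import Reals List Arith ClassicalEpsilon FunctionalExtensionality Lra Lia Permutation.
Import ListNotations.
Open Scope R_scope.

(** Expanding F_N in power sums, the logarithmic derivatives
    L(k_1..k_r) = sum over i of prod (i_j)_{k_j} d_{p_{i_1}}..d_{p_{i_r}} ln F_N
    at 1^N and the x-derivatives of Psi_N at 1^N are related by the chain rule
    for p_n = sum x_i^n: d_{i_1}..d_{i_r} Psi_N is the sum of L(block sizes) over
    the set partitions of {1..r} whose blocks carry a constant index.  The
    coarsest such partition has one block per distinct index, and every other
    one has more blocks, so the system is triangular and each family of limits
    determines the other.

    To avoid an infinite-variable chain rule for ln F_N, logarithmic derivatives
    are written as formal cumulant expressions in the quotients D F_N / F_N,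
    where D F_N is an absolutely convergent sum of iterated directional
    derivatives of the p_mu. *)

(** A letter is a velocity vector of the sequence $(p_m)_m$. Moving $p_n$ alone has the constant
    velocity [en n]. For $k\ge1$, differentiating $p_m=\sum_j x_j^m$ $k$ times in $x_i$ gives the
    entry $(m)_k x_i^{m-k}$, which at $x=1$ becomes [ff k] and forgets $i$; this is why only block
    sizes survive in the limit conditions. Both families of derivatives thus evaluate the same
    formal cumulant at $1^N$, with different letters. The obstacle is that [ff k] moves infinitely
    many $p_n$ at once: it has to be expanded as $\sum_n (n)_k e_n$ inside the cumulant. This is
    possible because a cumulant is linear in each letter, and tails of [ff k] are geometrically
    small when measured with a slightly larger radius. Assumption A reaches beyond $|x|=1$, and this
    slack pays for the analysis: one radius carries the absolute convergence, a smaller one, still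
    above 1, bounds points and letters, and the gap absorbs the polynomial factors in $|\mu|$
    produced by differentiation. *)

(** * Finite sums *)

Lemma sumR_ext {A} (l : list A) f g :
  (forall a, In a l -> f a = g a) -> sumR l f = sumR l g.
Proof.
  induction l as [|a l IH]; intros H; simpl; auto.
  rewrite H by (left; auto). rewrite IH; auto. intros; apply H; right; auto.
Qed.

Lemma sumR_app {A} (l l' : list A) f : sumR (l ++ l') f = sumR l f + sumR l' f.
Proof. induction l; simpl; [lra | rewrite IHl; lra]. Qed.

Lemma sumR_map {A B} (h : A -> B) (l : list A) f : sumR (map h l) f = sumR l (fun a => f (h a)).
Proof. induction l; simpl; congruence. Qed.

Lemma sumR_flat_map {A B} (h : A -> list B) (l : list A) f :
  sumR (flat_map h l) f = sumR l (fun a => sumR (h a) f).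
Proof. induction l; simpl; auto. rewrite sumR_app; congruence. Qed.

Lemma sumR_plus {A} (l : list A) f g : sumR l (fun a => f a + g a) = sumR l f + sumR l g.
Proof. induction l; simpl; [lra | rewrite IHl; lra]. Qed.

Lemma sumR_scal {A} (l : list A) c f : sumR l (fun a => c * f a) = c * sumR l f.
Proof. induction l; simpl; [lra | rewrite IHl; lra]. Qed.

Lemma sumR_zero {A} (l : list A) f : (forall a, In a l -> f a = 0) -> sumR l f = 0.
Proof.
  intros H. rewrite (sumR_ext l f (fun _ => 0) H).
  induction l; simpl; [auto|]. rewrite IHl; [lra|]. intros; apply H; right; auto.
Qed.

Lemma sumR_swap {A B} (l : list A) (l' : list B) f :
  sumR l (fun a => sumR l' (fun b => f a b)) = sumR l' (fun b => sumR l (fun a => f a b)).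
Proof.
  induction l; simpl.
  - symmetry; apply sumR_zero; auto.
  - rewrite IHl, <- sumR_plus; auto.
Qed.

Lemma sumR_perm {A} (l l' : list A) f : Permutation l l' -> sumR l f = sumR l' f.
Proof. induction 1; simpl; lra. Qed.

Lemma sumR_le {A} (l : list A) f g : (forall a, In a l -> f a <= g a) -> sumR l f <= sumR l g.
Proof.
  induction l as [|a l IH]; intros H; simpl; [lra|].
  apply Rplus_le_compat; [apply H; left; auto | apply IH; intros; apply H; right; auto].
Qed.

Lemma sumR_abs {A} (l : list A) f : Rabs (sumR l f) <= sumR l (fun a => Rabs (f a)).
Proof.
  induction l; simpl; [rewrite Rabs_R0; lra|].
  eapply Rle_trans; [apply Rabs_triang | lra].
Qed.

Lemma sumR_const {A} (l : list A) c : sumR l (fun _ => c) = INR (length l) * c.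
Proof.
  induction l; [simpl; lra|].
  replace (length (a :: l)) with (S (length l)) by auto. rewrite S_INR. simpl sumR. lra.
Qed.

Lemma derivable_pt_lim_sumR {A} (l : list A) (f : A -> R -> R) (f' : A -> R) t :
  (forall a, In a l -> derivable_pt_lim (f a) t (f' a)) ->
  derivable_pt_lim (fun s => sumR l (fun a => f a s)) t (sumR l f').
Proof.
  induction l as [|a l IH]; intros H; simpl.
  - apply derivable_pt_lim_const.
  - apply (derivable_pt_lim_plus (f a)); [apply H; left; auto | apply IH; intros; apply H; right; auto].
Qed.

Lemma derivable_pt_lim_eq f t l l' : derivable_pt_lim f t l -> l = l' -> derivable_pt_lim f t l'.
Proof. intros; subst; auto. Qed.

(** * Derivations and formal cumulants *)

(* [Lg] stands for ln F and [Tm S] for the quotient by F of the iterated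
   derivative of F along the letters of S. *)
Inductive ex (A : Type) : Type :=
| Cst (r : R)
| Lg
| Tm (S : list A)
| Add (e f : ex A)
| Mul (e f : ex A).
Arguments Cst {A} r.
Arguments Lg {A}.
Arguments Tm {A} S.
Arguments Add {A} e f.
Arguments Mul {A} e f.

Fixpoint ev {A} (l : R) (w : list A -> R) (e : ex A) : R :=
  match e with
  | Cst r => r
  | Lg => l
  | Tm T => w T
  | Add e f => ev l w e + ev l w f
  | Mul e f => ev l w e * ev l w f
  end.

Fixpoint der {A} (dL : ex A) (dT : list A -> ex A) (e : ex A) : ex A :=
  match e with
  | Cst r => Cst 0
  | Lg => dL
  | Tm T => dT T
  | Add e f => Add (der dL dT e) (der dL dT f)
  | Mul e f => Add (Mul (der dL dT e) f) (Mul e (der dL dT f))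
  end.

Definition esum {A} (l : list (ex A)) : ex A := fold_right Add (Cst 0) l.

(** The quotient rule for $D_SF/F$ along $c$, the letters of $S$ being held constant. *)
Definition quot {A} (c : A) (S : list A) : ex A :=
  Add (Tm (c :: S)) (Mul (Cst (-1)) (Mul (Tm S) (Tm [c]))).

Definition delta {A} (c : A) : ex A -> ex A := der (Tm [c]) (quot c).

(** The iterated derivative of $\ln F$ along constant vectors: the joint cumulant of the letters,
    with the quotients [Tm S] in the role of moments. *)
Fixpoint cum {A} (b : list A) : ex A :=
  match b with
  | [] => Lg
  | c :: b => delta c (cum b)
  end.

Lemma ev_esum {A} l w (L : list (ex A)) : ev l w (esum L) = sumR L (ev l w).
Proof. induction L; simpl; congruence. Qed.

Lemma ev_delta_esum {A} l w (c : A) L :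
  ev l w (delta c (esum L)) = sumR L (fun e => ev l w (delta c e)).
Proof. induction L; simpl; auto. unfold delta in *; simpl. rewrite IHL; auto. Qed.

Lemma ev_der_add {A} l w (dL dL' : ex A) dT dT' e :
  ev l w (der (Add dL dL') (fun S => Add (dT S) (dT' S)) e) =
  ev l w (der dL dT e) + ev l w (der dL' dT' e).
Proof. induction e; simpl; try rewrite IHe1, IHe2; ring. Qed.

Lemma ev_der {A} (l : R -> R) (w : R -> list A -> R) dL dT t :
  derivable_pt_lim l t (ev (l t) (w t) dL) ->
  (forall S, derivable_pt_lim (fun s => w s S) t (ev (l t) (w t) (dT S))) ->
  forall e, derivable_pt_lim (fun s => ev (l s) (w s) e) t (ev (l t) (w t) (der dL dT e)).
Proof.
  intros Hl Hw; induction e; simpl; auto.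
  - apply derivable_pt_lim_const.
  - apply (derivable_pt_lim_plus (fun s => ev (l s) (w s) e1) (fun s => ev (l s) (w s) e2)); auto.
  - apply (derivable_pt_lim_mult (fun s => ev (l s) (w s) e1) (fun s => ev (l s) (w s) e2)); auto.
Qed.

Lemma derivable_pt_lim_affine a b t : derivable_pt_lim (fun s => a + s * b) t b.
Proof.
  eapply derivable_pt_lim_eq.
  - apply (derivable_pt_lim_plus (fun _ => a) (fun s => s * b)); [apply derivable_pt_lim_const|].
    apply (derivable_pt_lim_mult (fun s => s) (fun _ => b));
      [apply derivable_pt_lim_id | apply derivable_pt_lim_const].
  - lra.
Qed.

(* Evaluating a derivation is differentiating the evaluation along a curve, so
   it depends only on the evaluation map of the expression. *)
Lemma ev_der_congr {A} (dL : ex A) dT e1 e2 :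
  (forall l w, ev l w e1 = ev l w e2) ->
  forall l w, ev l w (der dL dT e1) = ev l w (der dL dT e2).
Proof.
  intros H l w.
  pose (lt := fun t => l + t * ev l w dL).
  pose (wt := fun t S => w S + t * ev l w (dT S)).
  assert (L0 : lt 0 = l) by (unfold lt; lra).
  assert (W0 : wt 0 = w) by (unfold wt; apply functional_extensionality; intros; lra).
  assert (D : forall e, derivable_pt_lim (fun s => ev (lt s) (wt s) e) 0 (ev l w (der dL dT e))).
  { intros e. rewrite <- L0, <- W0 at 1. apply ev_der.
    - rewrite L0, W0. apply derivable_pt_lim_affine.
    - intros S. rewrite L0, W0. apply derivable_pt_lim_affine. }
  apply (uniqueness_limite (fun s => ev (lt s) (wt s) e1) 0); auto.
  replace (fun s => ev (lt s) (wt s) e1) with (fun s => ev (lt s) (wt s) e2); auto.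
  apply functional_extensionality; intros; auto.
Qed.

(** The curve argument again: a curve of weights on words in [B], pulled back along [h], is a curve
    of weights on words in [A], and the two evaluations agree along it. *)
Lemma ev_delta_map {A B} (h : A -> B) (l : R) (w : list B -> R) (c : A) e f :
  (forall l w, ev l (fun S => w (map h S)) e = ev l w f) ->
  ev l (fun S => w (map h S)) (delta c e) = ev l w (delta (h c) f).
Proof.
  intros H.
  set (wA := fun S => w (map h S)).
  pose (lt := fun t => l + t * ev l w (Tm [h c])).
  pose (wt := fun t S => w S + t * ev l w (quot (h c) S)).
  assert (L0 : lt 0 = l) by (unfold lt; lra).
  assert (W0 : wt 0 = w) by (unfold wt; apply functional_extensionality; intros; lra).
  assert (D : derivable_pt_lim (fun s => ev (lt s) (wt s) f) 0 (ev l w (delta (h c) f))).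
  { rewrite <- L0, <- W0 at 1. apply ev_der.
    - rewrite L0, W0. apply derivable_pt_lim_affine.
    - intros S. rewrite L0, W0. apply derivable_pt_lim_affine. }
  assert (D' : derivable_pt_lim (fun s => ev (lt s) (fun S => wt s (map h S)) e) 0 (ev l wA (delta c e))).
  { replace wA with (fun S => wt 0 (map h S)) by (rewrite W0; auto).
    rewrite <- L0 at 1. apply (ev_der lt (fun s S => wt s (map h S))).
    - rewrite L0, W0. apply derivable_pt_lim_affine.
    - intros S. rewrite L0, W0. apply derivable_pt_lim_affine. }
  apply (uniqueness_limite (fun s => ev (lt s) (wt s) f) 0); auto.
  replace (fun s => ev (lt s) (wt s) f) with (fun s => ev (lt s) (fun S => wt s (map h S)) e); auto.
  apply functional_extensionality; intros; auto.
Qed.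

(** Allows labels (indices, blocks) to serve as letters, replaced by the vectors they denote only at
    the point of evaluation. *)
Lemma ev_cum_map {A B} (h : A -> B) (b : list A) : forall l w,
  ev l (fun S => w (map h S)) (cum b) = ev l w (cum (map h b)).
Proof. induction b; intros l w; simpl; auto. apply ev_delta_map; auto. Qed.

(** * Derivatives that also act on the letters *)

(** The Leibniz rule for letters that vary with the point: [rs a] lists the terms of the derivative
    of [a], and exactly one letter is hit at a time. *)
Fixpoint raises {A} (rs : A -> list A) (b : list A) : list (list A) :=
  match b with
  | [] => []
  | a :: b => map (fun a' => a' :: b) (rs a) ++ map (cons a) (raises rs b)
  end.

Definition raise_der {A} (rs : A -> list A) : ex A -> ex A :=
  der (Cst 0) (fun S => esum (map Tm (raises rs S))).

(** The commutator of two derivations is a derivation, so it is determined on [Lg] and the [Tm S];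
    there it amounts to replacing [c] by its raises. *)
Lemma raise_delta_comm {A} (rs : A -> list A) c e l w :
  ev l w (raise_der rs (delta c e)) =
  ev l w (delta c (raise_der rs e)) + sumR (rs c) (fun c' => ev l w (delta c' e)).
Proof.
  induction e.
  - simpl. rewrite sumR_zero; auto; lra.
  - change (ev l w (raise_der rs (delta c Lg))) with (ev l w (esum (map Tm (raises rs [c])))).
    rewrite ev_esum, sumR_map. simpl. rewrite app_nil_r, sumR_map. lra.
  - change (delta c (raise_der rs (Tm S))) with (delta c (esum (map Tm (raises rs S)))).
    rewrite ev_delta_esum, sumR_map.
    change (ev l w (raise_der rs (delta c (Tm S)))) with
      (ev l w (esum (map Tm (raises rs (c :: S)))) +
       (0 * (w S * w [c]) + -1 * (ev l w (esum (map Tm (raises rs S))) * w [c] +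
          w S * ev l w (esum (map Tm (raises rs [c])))))).
    rewrite !ev_esum, !sumR_map. simpl.
    rewrite app_nil_r, sumR_app, !sumR_map.
    rewrite !sumR_plus, !sumR_scal.
    rewrite (sumR_ext (raises rs S) (fun a => w a * w [c]) (fun a => w [c] * w a)) by (intros; ring).
    rewrite sumR_scal. change (fun a : list A => w a) with w. ring.
  - unfold raise_der, delta in *. simpl. rewrite IHe1, IHe2, sumR_plus. ring.
  - unfold raise_der, delta in *. simpl. rewrite IHe1, IHe2, sumR_plus.
    rewrite sumR_scal.
    rewrite (sumR_ext (rs c) (fun a => _ * ev l w e2)
      (fun a => ev l w e2 * ev l w (der (Tm [a]) (quot a) e1))) by (intros; ring).
    rewrite sumR_scal. ring.
Qed.

Lemma raise_cum {A} (rs : A -> list A) b : forall l w,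
  ev l w (raise_der rs (cum b)) = sumR (raises rs b) (fun b' => ev l w (cum b')).
Proof.
  induction b as [|c b IH]; intros l w; simpl; auto.
  rewrite raise_delta_comm, sumR_app, !sumR_map. simpl.
  rewrite Rplus_comm. f_equal.
  unfold delta at 1.
  (* The induction hypothesis equates evaluations only, whereas [delta c] acts on syntax. *)
  rewrite (ev_der_congr _ _ (raise_der rs (cum b)) (esum (map cum (raises rs b)))).
  - fold (delta c). rewrite ev_delta_esum, sumR_map. auto.
  - intros. rewrite IH, ev_esum, sumR_map. auto.
Qed.

Section Branch.
Variables (A : Type) (vel : nat -> A) (rs : nat -> A -> list A).

(** A further derivative in coordinate [i] either moves the base point of $F$, which adds the letter
    [vel i], or hits a letter already present. Terms are listed with multiplicity. *)
Fixpoint branch (is : list nat) : list (list A) :=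
  match is with
  | [] => [[]]
  | i :: is => flat_map (fun b => (vel i :: b) :: raises (rs i) b) (branch is)
  end.

Lemma branch_step l w i is :
  sumR (branch is) (fun b => ev l w (delta (vel i) (cum b)) + ev l w (raise_der (rs i) (cum b)))
  = sumR (branch (i :: is)) (fun b => ev l w (cum b)).
Proof.
  simpl. rewrite sumR_flat_map. apply sumR_ext. intros b _. simpl.
  rewrite raise_cum. auto.
Qed.
End Branch.

(** * Set partitions into blocks of constant index *)

(* The pair (i, k) is a block of size k whose elements all carry the index i. *)
Definition block_raise (i : nat) (a : nat * nat) : list (nat * nat) :=
  if Nat.eqb i (fst a) then [(fst a, S (snd a))] else [].

Definition blocks : list nat -> list (list (nat * nat)) :=
  branch (nat * nat) (fun i => (i, 1%nat)) block_raise.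

Lemma raises_spec i b b' :
  In b' (raises (block_raise i) b) ->
  In i (map fst b) /\ map fst b' = map fst b /\ psize (map snd b') = S (psize (map snd b)) /\
  (Forall (fun k => (1 <= k)%nat) (map snd b) -> Forall (fun k => (1 <= k)%nat) (map snd b')).
Proof.
  revert b'; induction b as [|[j k] b IH]; simpl; intros b' H; [tauto|].
  apply in_app_or in H. destruct H as [H|H]; apply in_map_iff in H; destruct H as [a [E H]]; subst b'.
  - unfold block_raise in H; simpl in H. destruct (Nat.eqb_spec i j); simpl in H; [|tauto].
    destruct H as [<-|[]]. subst. simpl. repeat split; auto.
    intros F; inversion F; constructor; auto; lia.
  - apply IH in H. destruct H as [H1 [H2 [H3 H4]]]. simpl. rewrite H2, H3. repeat split; auto.
    intros F; inversion F; constructor; auto.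
Qed.

Lemma raises_nil i b : ~ In i (map fst b) -> raises (block_raise i) b = [].
Proof.
  intros H. destruct (raises (block_raise i) b) as [|b' l] eqn:E; auto.
  exfalso; apply H. apply (raises_spec i b b'). rewrite E; left; auto.
Qed.

Lemma blocks_spec is : forall b, In b (blocks is) ->
  psize (map snd b) = length is /\ Forall (fun k => (1 <= k)%nat) (map snd b) /\
  (forall j, In j is <-> In j (map fst b)).
Proof.
  induction is as [|i is IH]; simpl; intros b H.
  - destruct H as [<-|[]]. simpl. repeat split; auto; tauto.
  - apply in_flat_map in H. destruct H as [c [Hc H]].
    destruct (IH c Hc) as [H1 [H2 H3]]. destruct H as [<-|H].
    + simpl. rewrite H1. repeat split; auto; intros [->|K]; auto; right; apply H3; auto.
    + apply raises_spec in H. destruct H as [K1 [K2 [K3 K4]]].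
      rewrite K3, H1. split; [auto|]. split; [auto|].
      intros j. rewrite K2, <- H3. split; [|auto].
      intros [->|K]; auto. apply H3; auto.
Qed.

(** The indices of the derivative $\prod\partial_i^k$ attached to [b]. When the indices in [b] are
    distinct, [b] is its coarsest partition. *)
Definition spread (b : list (nat * nat)) : list nat :=
  flat_map (fun a => repeat (fst a) (snd a)) b.

Lemma in_spread j b : In j (spread b) -> In j (map fst b).
Proof.
  unfold spread; rewrite in_flat_map. intros [a [H K]]. apply repeat_spec in K. subst.
  apply in_map; auto.
Qed.

Lemma spread_in j b : Forall (fun k => (1 <= k)%nat) (map snd b) -> In j (map fst b) -> In j (spread b).
Proof.
  intros F H. apply in_map_iff in H. destruct H as [[i k] [<- H]].
  unfold spread; apply in_flat_map. exists (i, k); split; auto. simpl.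
  rewrite Forall_forall in F. assert (1 <= k)%nat by (apply F; apply (in_map snd _ (i, k)); auto).
  destruct k; [lia|]. left; auto.
Qed.

(** To keep a single block per index, every repetition of [i] must join the existing block; opening
    another block adds a part, and raising never removes one. *)
Lemma blocks_lead b :
  NoDup (map fst b) -> Forall (fun k => (1 <= k)%nat) (map snd b) ->
  exists rest, Permutation (blocks (spread b)) (b :: rest) /\
    forall c, In c rest -> (length b < length c)%nat.
Proof.
  induction b as [|[i k] b IH]; intros ND F.
  - exists []; split; [apply Permutation_refl | simpl; tauto].
  - simpl in *. inversion ND as [|? ? NI ND']; subst. inversion F as [|? ? K1 F']; subst.
    destruct (IH ND' F') as [rest [P L]]. clear IH.
    destruct k as [|k]; [lia|]. clear K1 F ND.
    change (spread ((i, S k) :: b)) with (repeat i (S k) ++ spread b).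
    induction k as [|k [rest' [P' L']]].
    + simpl. unfold blocks in *. simpl.
      exists (flat_map (fun b => ((i, 1%nat) :: b) :: raises (block_raise i) b) rest).
      split.
      * eapply Permutation_trans; [apply Permutation_flat_map; exact P|]. simpl.
        rewrite (raises_nil i b); auto.
      * intros c Hc. apply in_flat_map in Hc. destruct Hc as [d [Hd Hc]].
        destruct Hc as [<-|Hc]; [apply L in Hd; simpl; lia|].
        exfalso. apply raises_spec in Hc. destruct Hc as [Hc _]. apply NI.
        apply in_spread. apply (blocks_spec (spread b) d); auto.
        eapply Permutation_in; [apply Permutation_sym; exact P | right; auto].
    + change (repeat i (S (S k)) ++ spread b) with (i :: (repeat i (S k) ++ spread b)).
      unfold blocks in *.
      set (h := fun b => ((i, 1%nat) :: b) :: raises (block_raise i) b).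
      (* The old lead has two children: the one with the raised block is the new lead, the one with
         a second block of index [i] goes to the rest. *)
      exists (((i, 1%nat) :: (i, S k) :: b) :: flat_map h rest').
      split.
      * simpl branch. eapply Permutation_trans; [apply Permutation_flat_map; exact P'|].
        simpl. rewrite (raises_nil i b) by auto. unfold block_raise. simpl. rewrite Nat.eqb_refl. simpl.
        apply perm_swap.
      * intros c [<-|Hc]; [simpl; lia|].
        apply in_flat_map in Hc. destruct Hc as [d [Hd Hc]]. apply L' in Hd. simpl in Hd.
        destruct Hc as [<-|Hc]; [simpl; lia|].
        apply raises_spec in Hc. destruct Hc as [_ [Hc _]].
        apply (f_equal (@length nat)) in Hc. rewrite !length_map in Hc. lia.
Qed.

(** * Transfer of limits through a triangular system *)

Lemma Un_cv_sumR {A} (l : list A) (u : nat -> A -> R) (g : A -> R) :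
  (forall a, In a l -> Un_cv (fun N => u N a) (g a)) -> Un_cv (fun N => sumR l (u N)) (sumR l g).
Proof.
  induction l as [|a l IH]; intros H; simpl.
  - intros e He; exists 0%nat; intros; rewrite R_dist_eq; auto.
  - apply (CV_plus (fun N => u N a)); [apply H; left; auto | apply IH; intros; apply H; right; auto].
Qed.

Lemma Un_cv_ext_from n0 u v l : (forall n, (n0 <= n)%nat -> u n = v n) -> Un_cv u l -> Un_cv v l.
Proof.
  intros E H e He. destruct (H e He) as [n1 H1]. exists (max n0 n1). intros n Hn.
  rewrite <- E by lia. apply H1; lia.
Qed.

Lemma length_le_psize ks : Forall (fun k => (1 <= k)%nat) ks -> (length ks <= psize ks)%nat.
Proof. induction 1; simpl; lia. Qed.

Lemma map_combine {A B} (l : list A) (l' : list B) : length l = length l' ->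
  map fst (combine l l') = l /\ map snd (combine l l') = l'.
Proof.
  revert l'; induction l as [|a l IH]; intros [|b l'] H; simpl in *; try discriminate; auto.
  destruct (IH l') as [-> ->]; auto.
Qed.

Section Transfer.
(** [X] stands for the derivatives of $\Psi_N$ and [L] for the weighted sums over $p$-indices. The
    identity starts at some [n0] because $x_i$ is a variable only when $i\le N$. The scale [s] is
    $1/N$ or 1. *)
Variables (X L : nat -> list nat -> R).
Hypothesis HX : forall is, Forall (fun i => (1 <= i)%nat) is ->
  exists n0, forall N, (n0 <= N)%nat -> X N is = sumR (blocks is) (fun b => L N (map snd b)).
Variable s : nat -> R.

Definition pos (l : list nat) : Prop := Forall (fun k => (1 <= k)%nat) l.
Definition vanish_from r : Prop :=
  forall ks, pos ks -> (r <= length ks)%nat -> Un_cv (fun N => s N * L N ks) 0.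

(** Every partition of [is] has a block for each distinct index, hence at least [r] blocks. *)
Lemma vanish_deriv r D is :
  vanish_from r -> pos is -> NoDup D -> incl D is -> (r <= length D)%nat ->
  Un_cv (fun N => s N * X N is) 0.
Proof.
  intros V F ND I Hr. destruct (HX is F) as [n0 H0].
  apply (Un_cv_ext_from n0 (fun N => sumR (blocks is) (fun b => s N * L N (map snd b)))).
  - intros n Hn. rewrite H0 by auto. apply sumR_scal.
  - rewrite <- (sumR_zero (blocks is) (fun _ => 0)) by auto.
    apply (Un_cv_sumR (blocks is) (fun N b => s N * L N (map snd b))).
    intros b Hb. destruct (blocks_spec is b Hb) as [_ [H2 H3]].
    apply V; auto. rewrite length_map, <- (length_map fst).
    eapply Nat.le_trans; [exact Hr|]. apply NoDup_incl_length; auto.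
    intros j Hj. apply H3; auto.
Qed.

Lemma lead_rest (b : list (nat * nat)) : NoDup (map fst b) -> pos (map fst b) -> pos (map snd b) ->
  exists (rest : list (list (nat * nat))) n0,
    (forall N, (n0 <= N)%nat ->
      X N (spread b) = L N (map snd b) + sumR rest (fun c => L N (map snd c))) /\
    (forall c, In c rest -> (length b < length c)%nat /\ pos (map snd c) /\
                psize (map snd c) = psize (map snd b)).
Proof.
  intros ND Pf Ps. destruct (blocks_lead b ND Ps) as [rest [P Lr]].
  assert (F : pos (spread b)).
  { apply Forall_forall. intros j Hj. apply in_spread in Hj.
    unfold pos in Pf; rewrite Forall_forall in Pf; auto. }
  destruct (HX _ F) as [n0 H0]. exists rest, n0. split.
  - intros N HN. rewrite H0 by auto. rewrite (sumR_perm _ _ _ P). auto.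
  - intros c Hc. split; auto.
    assert (B : In b (blocks (spread b))).
    { eapply Permutation_in; [apply Permutation_sym; exact P | left; auto]. }
    assert (B' : In c (blocks (spread b))).
    { eapply Permutation_in; [apply Permutation_sym; exact P | right; auto]. }
    apply blocks_spec in B. apply blocks_spec in B'.
    destruct B as [B _]. destruct B' as [B' [B2 _]]. split; auto. congruence.
Qed.

(** Once the finer partitions are negligible, a derivative and its leading term have the same limit.
    The hypothesis is restricted to lists of the same size so that it can be fed by an induction at
    fixed size. *)
Lemma lead_cv (b : list (nat * nat)) c : NoDup (map fst b) -> pos (map fst b) -> pos (map snd b) ->
  (forall ks, pos ks -> psize ks = psize (map snd b) -> (length b < length ks)%nat ->
     Un_cv (fun N => s N * L N ks) 0) ->
  (Un_cv (fun N => s N * X N (spread b)) c <-> Un_cv (fun N => s N * L N (map snd b)) c).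
Proof.
  intros ND Pf Ps V. destruct (lead_rest b ND Pf Ps) as [rest [n0 [E R]]].
  assert (C0 : Un_cv (fun N => sumR rest (fun d => s N * L N (map snd d))) 0).
  { rewrite <- (sumR_zero rest (fun _ => 0)) by auto.
    apply (Un_cv_sumR rest (fun N d => s N * L N (map snd d))).
    intros d Hd. destruct (R d Hd) as [R1 [R2 R3]]. apply V; auto. rewrite length_map; auto. }
  split; intros H.
  - apply (Un_cv_ext_from n0 (fun N => s N * X N (spread b) - sumR rest (fun d => s N * L N (map snd d)))).
    + intros n Hn. rewrite E by auto. rewrite sumR_scal. ring.
    + replace c with (c - 0) by ring. apply CV_minus; auto.
  - apply (Un_cv_ext_from n0 (fun N => s N * L N (map snd b) + sumR rest (fun d => s N * L N (map snd d)))).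
    + intros n Hn. rewrite E by auto. rewrite sumR_scal. ring.
    + replace c with (c + 0) by ring. apply CV_plus; auto.
Qed.

(* Induction on the number of merges psize ks - length ks: the other terms in
   the derivative attached to ks have the same size and more parts. *)
Lemma vanish_from_deriv r :
  (forall is D, pos is -> NoDup D -> incl D is -> length D = r ->
     Un_cv (fun N => s N * X N is) 0) ->
  vanish_from r.
Proof.
  intros H ks Pk Hr. remember (psize ks - length ks)%nat as d eqn:Ed.
  revert ks Pk Hr Ed. induction d as [d IH] using lt_wf_ind. intros ks Pk Hr Ed.
  (* Giving the parts of [ks] the distinct indices 1, 2, ... makes [ks] the leading term of a
     derivative. *)
  pose (b := combine (seq 1 (length ks)) ks).
  assert (Lb : length (seq 1 (length ks)) = length ks) by apply length_seq.
  assert (Fb : map fst b = seq 1 (length ks)) by (apply map_combine; auto).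
  assert (Sb : map snd b = ks) by (apply map_combine; auto).
  assert (Lb' : length b = length ks) by (rewrite <- Sb, length_map; auto).
  assert (Pb : pos (map fst b)).
  { rewrite Fb. apply Forall_forall. intros j Hj. apply in_seq in Hj. lia. }
  rewrite <- Sb. apply lead_cv; auto.
  - rewrite Fb; apply seq_NoDup.
  - rewrite Sb; auto.
  - rewrite Sb, Lb'. intros ks' P' E' L'.
    apply (IH (psize ks' - length ks')%nat); auto; try lia.
    pose proof (length_le_psize ks' P'). lia.
  - apply (H _ (seq 1 r)).
    + apply Forall_forall. intros j Hj. apply in_spread in Hj.
      unfold pos in Pb; rewrite Forall_forall in Pb; auto.
    + apply seq_NoDup.
    + intros j Hj. apply spread_in; [rewrite Sb; auto|]. rewrite Fb.
      apply in_seq in Hj. apply in_seq. lia.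
    + apply length_seq.
Qed.
End Transfer.

Lemma pt_aux_spec fuel : forall m n mu, In mu (pt_aux fuel m n) ->
  psize mu = n /\ Forall (fun k => (1 <= k)%nat) mu.
Proof.
  induction fuel as [|f IH]; intros m [|n] mu H; simpl in H.
  - destruct H as [<-|[]]; auto.
  - tauto.
  - destruct H as [<-|[]]; auto.
  - change (In mu (flat_map (fun k => map (cons k) (pt_aux f k (S n - k))) (seq 1 (Nat.min m (S n))))) in H.
    apply in_flat_map in H. destruct H as [k [Hk H]]. apply in_seq in Hk.
    apply in_map_iff in H. destruct H as [nu [<- H]]. apply IH in H. destruct H as [H1 H2].
    split; [simpl; lia | constructor; auto; lia].
Qed.

Lemma parts_spec n mu : In mu (parts n) -> psize mu = n /\ Forall (fun k => (1 <= k)%nat) mu.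
Proof. apply pt_aux_spec. Qed.

(** * Series *)

Lemma Series_eq u l : infinite_sum u l -> Series u = l.
Proof.
  intros H. apply (uniqueness_sum u); auto. unfold Series. apply epsilon_spec. exists l; auto.
Qed.

Lemma infinite_sum_scal u l c : infinite_sum u l -> infinite_sum (fun n => c * u n) (c * l).
Proof.
  intros H. change (Un_cv (fun n => sum_f_R0 (fun k => c * u k) n) (c * l)).
  apply (Un_cv_ext_from 0 (fun n => c * sum_f_R0 u n)).
  - intros n _. rewrite scal_sum. apply sum_eq. intros; ring.
  - apply (CV_mult (fun _ => c)); auto.
    intros e He; exists 0%nat; intros; rewrite R_dist_eq; auto.
Qed.

Lemma infinite_sum_plus u v l l' :
  infinite_sum u l -> infinite_sum v l' -> infinite_sum (fun n => u n + v n) (l + l').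
Proof.
  intros H H'. change (Un_cv (fun n => sum_f_R0 (fun k => u k + v k) n) (l + l')).
  apply (Un_cv_ext_from 0 (fun n => sum_f_R0 u n + sum_f_R0 v n)).
  - intros n _. rewrite <- plus_sum. auto.
  - apply CV_plus; auto.
Qed.

Lemma infinite_sum_ext u v l : (forall n, u n = v n) -> infinite_sum u l -> infinite_sum v l.
Proof.
  intros E H. replace v with u; auto. apply functional_extensionality; auto.
Qed.

Lemma infinite_sum_zero : infinite_sum (fun _ => 0) 0.
Proof.
  intros e He. exists 0%nat. intros n _.
  rewrite (sum_eq_R0 (fun _ => 0)); auto. rewrite R_dist_eq; auto.
Qed.

Lemma Rabs_sum_f_R0_le u b n : (forall k, Rabs (u k) <= b k) -> Rabs (sum_f_R0 u n) <= sum_f_R0 b n.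
Proof.
  intros H. eapply Rle_trans; [apply sum_f_R0_triangle|]. apply sum_Rle. intros; auto.
Qed.

Lemma Un_cv_le_const u l c : Un_cv u l -> (exists n0, forall n, (n0 <= n)%nat -> u n <= c) -> l <= c.
Proof.
  intros H [n0 H0]. destruct (Rle_dec l c) as [|Hn]; auto. exfalso.
  destruct (H (l - c)) as [n1 H1]; [lra|].
  specialize (H1 (max n0 n1) ltac:(lia)). specialize (H0 (max n0 n1) ltac:(lia)).
  unfold Rdist in H1. apply Rabs_def2 in H1. lra.
Qed.

Lemma Un_cv_abs_le u l c : Un_cv u l -> (exists n0, forall n, (n0 <= n)%nat -> Rabs (u n) <= c) -> Rabs l <= c.
Proof. intros H H0. apply (Un_cv_le_const (fun n => Rabs (u n))); auto. apply cv_cvabs; auto. Qed.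

Lemma infinite_sum_comp u b B : (forall n, Rabs (u n) <= b n) -> infinite_sum b B ->
  exists l, infinite_sum u l /\ Rabs l <= B.
Proof.
  intros H HB.
  assert (P : {l : R | Un_cv (fun N => sum_f_R0 (fun n => Rabs (u n)) N) l}).
  { apply (Rseries_CV_comp (fun n => Rabs (u n)) b); [intros; split; auto; apply Rabs_pos|].
    exists B; auto. }
  assert (Q : {l : R | Un_cv (fun N => sum_f_R0 u N) l}).
  { apply cv_cauchy_2, cauchy_abs, cv_cauchy_1; auto. }
  destruct Q as [l Hl]. exists l; split; auto.
  apply (Un_cv_abs_le _ _ _ Hl). exists 0%nat. intros n _.
  eapply Rle_trans; [apply (Rabs_sum_f_R0_le u b); auto|].
  apply sum_incr; auto. intros k. eapply Rle_trans; [apply Rabs_pos | apply H].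
Qed.

Lemma derivable_pt_lim_sum_f_R0 (g : nat -> R -> R) (g' : nat -> R) t n :
  (forall k, derivable_pt_lim (g k) t (g' k)) ->
  derivable_pt_lim (fun s => sum_f_R0 (fun k => g k s) n) t (sum_f_R0 g' n).
Proof.
  intros H; induction n; simpl; auto.
  apply (derivable_pt_lim_plus (fun s => sum_f_R0 (fun k => g k s) n)); auto.
Qed.

(** By the mean value theorem each difference quotient is bounded by the majorant [b n], so the
    tails of the difference quotients are small uniformly in the increment. *)
Lemma series_deriv (g g' : nat -> R -> R) b B (G : R -> R) l t0 eta :
  0 < eta -> infinite_sum b B ->
  (forall n t, Rabs (t - t0) < eta -> derivable_pt_lim (g n) t (g' n t) /\ Rabs (g' n t) <= b n) ->
  (forall t, Rabs (t - t0) < eta -> infinite_sum (fun n => g n t) (G t)) ->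
  infinite_sum (fun n => g' n t0) l ->
  derivable_pt_lim G t0 l.
Proof.
  intros He HB HD HG Hl eps Heps.
  assert (T0 : Rabs (t0 - t0) < eta) by (rewrite Rminus_diag, Rabs_R0; auto).
  assert (Bt : exists m0, forall m n, (m0 <= m)%nat -> (m <= n)%nat ->
     sum_f_R0 b n - sum_f_R0 b m < eps / 4).
  { destruct (CV_Cauchy _ (exist _ B HB) (eps / 4)) as [m0 Hm]; [lra|].
    exists m0. intros m n H1 H2. specialize (Hm n m ltac:(lia) ltac:(lia)).
    unfold Rdist in Hm. apply Rabs_def2 in Hm. lra. }
  destruct Bt as [m0 Bt].
  destruct (Hl (eps / 4)) as [m1 Hm1]; [lra|].
  (* One cut-off for both the tail of the majorant and the tail of the differentiated series; the
     finite part then fixes the size of the increment. *)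
  set (m := max m0 m1).
  assert (Dm := derivable_pt_lim_sum_f_R0 g (fun k => g' k t0) t0 m (fun k => proj1 (HD k t0 T0))).
  destruct (Dm (eps / 4)) as [d Hd]; [lra|].
  assert (Hmin : 0 < Rmin d eta) by (apply Rmin_pos; [apply cond_pos | auto]).
  exists (mkposreal _ Hmin). simpl. intros h Hh Hhd.
  assert (Hhd1 : Rabs h < d) by (eapply Rlt_le_trans; [exact Hhd | apply Rmin_l]).
  assert (Hhd2 : Rabs h < eta) by (eapply Rlt_le_trans; [exact Hhd | apply Rmin_r]).
  specialize (Hd h Hh Hhd1).
  assert (T1 : Rabs (t0 + h - t0) < eta) by (replace (t0 + h - t0) with h by ring; auto).
  assert (Term : forall n, Rabs (g n (t0 + h) - g n t0) <= b n * Rabs h).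
  { intros n. destruct (MVT_abs (g n) (g' n) t0 (t0 + h)) as [x [Ex Hx]].
    - intros x Hx. apply HD. unfold Rmin, Rmax in Hx.
      destruct (Rle_dec t0 (t0 + h)); apply Rabs_def1; apply Rabs_def2 in Hhd2; lra.
    - rewrite Ex. replace (t0 + h - t0) with h by ring.
      apply Rmult_le_compat_r; [apply Rabs_pos|]. apply HD.
      unfold Rmin, Rmax in Hx.
      destruct (Rle_dec t0 (t0 + h)); apply Rabs_def1; apply Rabs_def2 in Hhd2; lra. }
  assert (Tail : forall n, (m <= n)%nat ->
     Rabs ((sum_f_R0 (fun k => g k (t0 + h)) n - sum_f_R0 (fun k => g k t0) n) -
           (sum_f_R0 (fun k => g k (t0 + h)) m - sum_f_R0 (fun k => g k t0) m))
     <= (sum_f_R0 b n - sum_f_R0 b m) * Rabs h).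
  { induction 1 as [|n Hn IH].
    - rewrite !Rminus_diag, Rabs_R0. lra.
    - simpl sum_f_R0. specialize (Term (S n)).
      match goal with |- Rabs ?x <= _ =>
        replace x with (((sum_f_R0 (fun k => g k (t0 + h)) n - sum_f_R0 (fun k => g k t0) n) -
           (sum_f_R0 (fun k => g k (t0 + h)) m - sum_f_R0 (fun k => g k t0) m)) +
           (g (S n) (t0 + h) - g (S n) t0)) by ring end.
      eapply Rle_trans; [apply Rabs_triang|]. lra. }
  assert (Lim : Rabs ((G (t0 + h) - G t0) -
           (sum_f_R0 (fun k => g k (t0 + h)) m - sum_f_R0 (fun k => g k t0) m)) <= eps / 4 * Rabs h).
  { eapply Un_cv_abs_le.
    - apply (CV_minus (fun n => sum_f_R0 (fun k => g k (t0 + h)) n - sum_f_R0 (fun k => g k t0) n)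
         (fun _ => sum_f_R0 (fun k => g k (t0 + h)) m - sum_f_R0 (fun k => g k t0) m)).
      + apply CV_minus; [apply (HG (t0 + h)) | apply (HG t0)]; auto.
      + intros e E; exists 0%nat; intros; rewrite R_dist_eq; auto.
    - exists m. intros n Hn. eapply Rle_trans; [apply Tail; auto|].
      apply Rmult_le_compat_r; [apply Rabs_pos|]. apply Rlt_le, Bt; auto. unfold m; lia. }
  specialize (Hm1 m ltac:(unfold m; lia)). unfold Rdist in Hm1.
  set (SM := sum_f_R0 (fun k => g k (t0 + h)) m) in *.
  set (SM0 := sum_f_R0 (fun k => g k t0) m) in *.
  set (SD := sum_f_R0 (fun k => g' k t0) m) in *.
  replace ((G (t0 + h) - G t0) / h - l) with
    (((G (t0 + h) - G t0) - (SM - SM0)) / h + ((SM - SM0) / h - SD) + (SD - l)) by (field; auto).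
  assert (K : Rabs (((G (t0 + h) - G t0) - (SM - SM0)) / h) <= eps / 4).
  { unfold Rdiv. rewrite Rabs_mult, Rabs_inv.
    apply (Rmult_le_reg_r (Rabs h)); [apply Rabs_pos_lt; auto|].
    rewrite Rmult_assoc, Rinv_l by (apply Rabs_no_R0; auto). rewrite Rmult_1_r. auto. }
  eapply Rle_lt_trans; [apply Rabs_triang|].
  eapply Rle_lt_trans; [apply Rplus_le_compat_r; apply Rabs_triang|]. lra.
Qed.

Lemma Bernoulli x n : 0 <= x -> 1 + INR n * x <= (1 + x) ^ n.
Proof.
  intros H; induction n; [simpl; lra|].
  rewrite S_INR. simpl pow. pose proof (pos_INR n).
  assert ((1 + x) * (1 + INR n * x) <= (1 + x) * (1 + x) ^ n) by (apply Rmult_le_compat_l; lra).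
  nra.
Qed.

(** With $r=(1+x)s$, Bernoulli gives $nx\le(1+x)^n$, hence the constant $1/x$. *)
Lemma linear_le_geom s r : 0 < s < r -> exists C, 0 <= C /\ forall n, INR n * s ^ n <= C * r ^ n.
Proof.
  intros [Hs Hr]. set (x := r / s - 1).
  assert (Hx : 0 < x).
  { unfold x. assert (1 < r / s); [|lra]. apply (Rmult_lt_reg_r s); auto.
    unfold Rdiv. rewrite Rmult_assoc, Rinv_l; lra. }
  exists (/ x). split; [apply Rlt_le, Rinv_0_lt_compat; auto|]. intros n.
  replace r with ((1 + x) * s) by (unfold x; field; lra).
  rewrite Rpow_mult_distr, <- Rmult_assoc. apply Rmult_le_compat_r; [apply pow_le; lra|].
  apply (Rmult_le_reg_l x); auto. rewrite <- Rmult_assoc, Rinv_r, Rmult_1_l by lra.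
  pose proof (Bernoulli x n ltac:(lra)). lra.
Qed.

(** Each derivative will cost a factor $|\mu|$, paid for by enlarging the radius. Splitting the gap
    at the midpoint leaves room for the remaining factors. *)
Lemma poly_le_geom k : forall s r, 0 < s < r -> exists C, 0 <= C /\ forall n, INR n ^ k * s ^ n <= C * r ^ n.
Proof.
  induction k as [|k IH]; intros s r H.
  - exists 1. split; [lra|]. intros n. simpl. rewrite !Rmult_1_l. apply pow_incr; lra.
  - destruct (linear_le_geom s ((s + r) / 2)) as [C1 [P1 H1]]; [lra|].
    destruct (IH ((s + r) / 2) r) as [C2 [P2 H2]]; [lra|].
    exists (C1 * C2). split; [apply Rmult_le_pos; auto|]. intros n.
    specialize (H1 n). specialize (H2 n). simpl pow.
    replace (INR n * INR n ^ k * s ^ n) with (INR n ^ k * (INR n * s ^ n)) by ring.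
    eapply Rle_trans; [apply Rmult_le_compat_l; [apply pow_le, pos_INR | exact H1]|].
    replace (INR n ^ k * (C1 * ((s + r) / 2) ^ n)) with (C1 * (INR n ^ k * ((s + r) / 2) ^ n)) by ring.
    rewrite Rmult_assoc. apply Rmult_le_compat_l; auto.
Qed.

(** * Iterated directional derivatives of power-sum products *)

(** One entry per occurrence of a part, so that sums over [picks] count multiplicities as the
    product rule does. *)
Fixpoint picks (mu : list nat) : list (nat * list nat) :=
  match mu with
  | [] => []
  | m :: mu => (m, mu) :: map (fun q => (fst q, m :: snd q)) (picks mu)
  end.

Lemma picks_spec mu m mu' : In (m, mu') (picks mu) -> Permutation mu (m :: mu').
Proof.
  revert mu'; induction mu as [|a mu IH]; simpl; intros mu' H; [tauto|].
  destruct H as [H|H].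
  - inversion H; subst; auto.
  - apply in_map_iff in H. destruct H as [[x nu] [E H]]. inversion E; subst; simpl in *.
    eapply Permutation_trans; [apply perm_skip, IH, H | apply perm_swap].
Qed.

Lemma length_picks mu : length (picks mu) = length mu.
Proof. induction mu; simpl; auto. rewrite length_map; auto. Qed.

Lemma psize_perm l l' : Permutation l l' -> psize l = psize l'.
Proof. induction 1; simpl; lia. Qed.

(** Removing two parts in either order gives the same pairs; this is the symmetry of second
    derivatives. *)
Lemma sum_picks2_swap mu : forall g : nat -> nat -> list nat -> R,
  sumR (picks mu) (fun q => sumR (picks (snd q)) (fun q' => g (fst q) (fst q') (snd q'))) =
  sumR (picks mu) (fun q => sumR (picks (snd q)) (fun q' => g (fst q') (fst q) (snd q'))).
Proof.
  induction mu as [|m mu IH]; intros g; simpl; auto.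
  rewrite !sumR_map. simpl. rewrite !sumR_plus.
  assert (E : forall h : nat -> list nat -> nat -> list nat -> R,
    sumR (picks mu) (fun q => sumR (map (fun r => (fst r, m :: snd r)) (picks (snd q)))
      (fun q' => h (fst q) (snd q) (fst q') (snd q'))) =
    sumR (picks mu) (fun q => sumR (picks (snd q)) (fun q' => h (fst q) (snd q) (fst q') (m :: snd q')))).
  { intros h. apply sumR_ext. intros. rewrite sumR_map. auto. }
  rewrite (E (fun a _ b l => g a b l)), (E (fun a _ b l => g b a l)).
  rewrite (IH (fun a b l => g a b (m :: l))). ring.
Qed.

Fixpoint dm (vs : list (nat -> R)) (p : nat -> R) (mu : list nat) : R :=
  match vs with
  | [] => pprod mu p
  | v :: vs => sumR (picks mu) (fun q => v (fst q) * dm vs p (snd q))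
  end.

Lemma dm_swap u v vs p mu : dm (u :: v :: vs) p mu = dm (v :: u :: vs) p mu.
Proof.
  simpl.
  rewrite (sumR_ext (picks mu) _ (fun q => sumR (picks (snd q)) (fun q' => u (fst q) * v (fst q') * dm vs p (snd q')))).
  2:{ intros; rewrite <- sumR_scal. apply sumR_ext; intros; ring. }
  rewrite (sum_picks2_swap mu (fun a b l => u a * v b * dm vs p l)).
  apply sumR_ext; intros. rewrite <- sumR_scal. apply sumR_ext; intros; ring.
Qed.

Lemma dm_linear S1 S2 a u v p : forall mu,
  dm (S1 ++ (fun m => a * u m + v m) :: S2) p mu = a * dm (S1 ++ u :: S2) p mu + dm (S1 ++ v :: S2) p mu.
Proof.
  induction S1 as [|z S1 IH]; intros mu; simpl; rewrite <- sumR_scal, <- sumR_plus; apply sumR_ext; intros.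
  - ring.
  - rewrite IH. ring.
Qed.

Lemma pprod_cons m mu p : pprod (m :: mu) p = p m * pprod mu p.
Proof. auto. Qed.

Lemma pprod_deriv (pt : R -> nat -> R) u t mu :
  (forall m, In m mu -> derivable_pt_lim (fun s => pt s m) t (u m)) ->
  derivable_pt_lim (fun s => pprod mu (pt s)) t (dm [u] (pt t) mu).
Proof.
  induction mu as [|m mu IH]; intros H; simpl.
  - unfold pprod; simpl. apply derivable_pt_lim_const.
  - eapply derivable_pt_lim_eq.
    + apply (derivable_pt_lim_mult (fun s => pt s m) (fun s => pprod mu (pt s))).
      * apply H; left; auto.
      * apply IH; intros; apply H; right; auto.
    + simpl. rewrite sumR_map. simpl. rewrite <- sumR_scal. f_equal.
      apply sumR_ext; intros. unfold pprod; simpl. ring.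
Qed.

(** The analytic counterpart of one step of [branch]: the motion of the base point contributes the
    new letter [u], the motion of the letters contributes the raises. *)
Lemma dm_deriv {A} (V : A -> R -> nat -> R) (rs : A -> list A) (pt : R -> nat -> R) u t S :
  (forall a m, derivable_pt_lim (fun s => V a s m) t (sumR (rs a) (fun a' => V a' t m))) ->
  forall mu, (forall m, In m mu -> derivable_pt_lim (fun s => pt s m) t (u m)) ->
  derivable_pt_lim (fun s => dm (map (fun a => V a s) S) (pt s) mu) t
    (dm (u :: map (fun a => V a t) S) (pt t) mu +
     sumR (raises rs S) (fun S' => dm (map (fun a => V a t) S') (pt t) mu)).
Proof.
  intros HV. induction S as [|a S IH]; intros mu Hp.
  - simpl map. simpl raises. eapply derivable_pt_lim_eq; [apply pprod_deriv; eauto|]. simpl; ring.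
  (* With [V a t] in front of [u], both sides are sums over [picks mu] and can be compared term by
     term. *)
  - simpl map. simpl raises. rewrite dm_swap.
    eapply derivable_pt_lim_eq.
    + apply (derivable_pt_lim_sumR (picks mu)
        (fun q s => V a s (fst q) * dm (map (fun a0 => V a0 s) S) (pt s) (snd q))
        (fun q => sumR (rs a) (fun a' => V a' t (fst q)) * dm (map (fun a0 => V a0 t) S) (pt t) (snd q) +
           V a t (fst q) * (dm (u :: map (fun a0 => V a0 t) S) (pt t) (snd q) +
             sumR (raises rs S) (fun S' => dm (map (fun a0 => V a0 t) S') (pt t) (snd q))))).
      intros [m nu] Hq. simpl fst. simpl snd.
      apply (derivable_pt_lim_mult (fun s => V a s m) (fun s => dm (map (fun a0 => V a0 s) S) (pt s) nu)).
      * apply HV.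
      * apply IH. intros k Hk. apply Hp. apply picks_spec in Hq.
        eapply Permutation_in; [apply Permutation_sym; exact Hq | right; auto].
    + cbv beta. rewrite sumR_app, !sumR_map.
      simpl (dm (V a t :: _) _ _).
      rewrite (sumR_ext (rs a) _ (fun a' => sumR (picks mu) (fun q => V a' t (fst q) *
          dm (map (fun a0 => V a0 t) S) (pt t) (snd q)))) by auto.
      rewrite (sumR_ext (raises rs S) _ (fun S' => sumR (picks mu) (fun q => V a t (fst q) *
          dm (map (fun a0 => V a0 t) S') (pt t) (snd q)))) by auto.
      rewrite (sumR_swap (rs a)), (sumR_swap (raises rs S)), <- !sumR_plus.
      apply sumR_ext. intros [m nu] _. simpl.
      rewrite sumR_scal.
      rewrite (sumR_ext (rs a) (fun a0 => V a0 t m * _) (fun a0 =>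
         dm (map (fun a0 => V a0 t) S) (pt t) nu * V a0 t m)) by (intros; ring).
      rewrite sumR_scal. ring.
Qed.

Definition bd (K rho : R) (v : nat -> R) : Prop := forall m, Rabs (v m) <= K * rho ^ m.

Lemma pprod_bound (n1 rho : R) p mu : 0 < n1 -> 0 < rho ->
  (forall m, (1 <= m)%nat -> Rabs (p m) <= n1 * rho ^ m) -> Forall (fun k => (1 <= k)%nat) mu ->
  Rabs (pprod mu p) <= n1 ^ length mu * rho ^ psize mu.
Proof.
  intros Hn Hr Hp F; induction F as [|m mu Hm F IH].
  - unfold pprod; simpl. rewrite Rabs_R1. lra.
  - rewrite pprod_cons, Rabs_mult. simpl. rewrite pow_add.
    replace (n1 * n1 ^ length mu * (rho ^ m * rho ^ psize mu)) with
      ((n1 * rho ^ m) * (n1 ^ length mu * rho ^ psize mu)) by ring.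
    apply Rmult_le_compat; auto using Rabs_pos.
Qed.

(** Each letter has [length mu <= psize mu] parts to remove, and a removed factor is bounded with
    [K] instead of [n1]; [1 <= n1] restores the missing power of [n1]. *)
Lemma dm_bound (n1 rho K : R) p vs : 1 <= n1 -> 0 < rho -> 0 <= K ->
  (forall m, (1 <= m)%nat -> Rabs (p m) <= n1 * rho ^ m) -> Forall (bd K rho) vs ->
  forall mu, Forall (fun k => (1 <= k)%nat) mu ->
  Rabs (dm vs p mu) <= K ^ length vs * (INR (psize mu) ^ length vs * (n1 ^ length mu * rho ^ psize mu)).
Proof.
  intros Hn Hr HK Hp Fv; induction Fv as [|v vs Hv Fv IH]; intros mu F.
  - simpl. rewrite !Rmult_1_l. apply pprod_bound; auto; lra.
  - simpl dm. eapply Rle_trans; [apply sumR_abs|].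
    eapply Rle_trans.
    + apply (sumR_le _ _ (fun _ => K ^ S (length vs) * (INR (psize mu) ^ length vs * (n1 ^ length mu * rho ^ psize mu)))).
      intros [m nu] Hq. simpl fst. simpl snd. apply picks_spec in Hq.
      assert (F' : Forall (fun k => (1 <= k)%nat) (m :: nu)) by (eapply Permutation_Forall; eauto).
      assert (Fn : Forall (fun k => (1 <= k)%nat) nu) by (inversion F'; auto).
      rewrite (Permutation_length Hq), (psize_perm _ _ Hq). simpl length. simpl psize.
      rewrite Rabs_mult.
      eapply Rle_trans; [apply Rmult_le_compat; [apply Rabs_pos | apply Rabs_pos | apply Hv | apply IH; auto]|].
      rewrite pow_add. simpl pow.
      assert (I1 : INR (psize nu) ^ length vs <= INR (m + psize nu) ^ length vs).
      { apply pow_incr. split; [apply pos_INR | apply le_INR; lia]. }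
      assert (I2 : n1 ^ length nu <= n1 * n1 ^ length nu).
      { pose proof (pow_le n1 (length nu) ltac:(lra)). nra. }
      match goal with |- ?x <= _ => replace x with
        ((K * K ^ length vs * (rho ^ m * rho ^ psize nu)) * (INR (psize nu) ^ length vs * n1 ^ length nu)) by ring end.
      match goal with |- _ <= ?x => replace x with
        ((K * K ^ length vs * (rho ^ m * rho ^ psize nu)) *
          (INR (m + psize nu) ^ length vs * (n1 * n1 ^ length nu))) by ring end.
      apply Rmult_le_compat_l.
      * repeat apply Rmult_le_pos; auto; apply pow_le; lra.
      * apply Rmult_le_compat; auto; apply pow_le; [apply pos_INR | lra].
    + rewrite sumR_const, length_picks.
      assert (I : INR (length mu) <= INR (psize mu)) by (apply le_INR, length_le_psize; auto).
      simpl length. simpl pow.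
      match goal with |- _ <= ?x => replace x with (INR (psize mu) *
        (K * K ^ length vs * (INR (psize mu) ^ length vs * (n1 ^ length mu * rho ^ psize mu)))) by ring end.
      apply Rmult_le_compat_r; auto.
      repeat apply Rmult_le_pos; auto; apply pow_le; auto using pos_INR; lra.
Qed.

(** * Coordinate updates and one-variable derivatives *)

Lemma upd_same p i : upd p i (p i) = p.
Proof.
  apply functional_extensionality; intros j. unfold upd. destruct (Nat.eqb_spec j i); subst; auto.
Qed.

Lemma upd_upd p i s t : upd (upd p i s) i t = upd p i t.
Proof. apply functional_extensionality; intros j. unfold upd. destruct (Nat.eqb j i); auto. Qed.

Lemma upd_eq p i t : upd p i t i = t.
Proof. unfold upd. rewrite Nat.eqb_refl; auto. Qed.

Lemma Dpt_eq f t l : derivable_pt_lim f t l -> Dpt f t = l.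
Proof.
  intros H. apply (uniqueness_limite f t); auto. unfold Dpt. apply epsilon_spec. exists l; auto.
Qed.

Lemma derivable_pt_lim_near f g t l eta : 0 < eta ->
  (forall x, Rabs (x - t) < eta -> f x = g x) -> derivable_pt_lim f t l -> derivable_pt_lim g t l.
Proof.
  intros He E H eps Heps. destruct (H eps Heps) as [d Hd].
  assert (Hm : 0 < Rmin d eta) by (apply Rmin_pos; [apply cond_pos | auto]).
  exists (mkposreal _ Hm). simpl. intros h Hh Hl.
  rewrite <- !E.
  - apply Hd; auto. eapply Rlt_le_trans; [exact Hl | apply Rmin_l].
  - rewrite Rminus_diag, Rabs_R0; auto.
  - replace (t + h - t) with h by ring. eapply Rlt_le_trans; [exact Hl | apply Rmin_r].
Qed.

Lemma derivable_pt_lim_pos_near f t l : derivable_pt_lim f t l -> 0 < f t ->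
  exists eta, 0 < eta /\ forall x, Rabs (x - t) < eta -> 0 < f x.
Proof.
  intros H Hp. assert (D : derivable_pt f t) by (exists l; auto).
  apply derivable_continuous_pt in D.
  destruct (D (f t) Hp) as [d [Hd HD]]. exists d; split; auto. intros x Hx.
  destruct (Req_dec x t) as [->|Hne]; auto.
  specialize (HD x). simpl in HD. unfold Rdist, D_x, no_cond in HD.
  assert (Rabs (f x - f t) < f t) by (apply HD; auto).
  apply Rabs_def2 in H0. lra.
Qed.

Lemma derivable_pt_lim_ln_comp f t l : derivable_pt_lim f t l -> 0 < f t ->
  derivable_pt_lim (fun s => ln (f s)) t (l / f t).
Proof.
  intros H Hp. eapply derivable_pt_lim_eq.
  - apply (derivable_pt_lim_comp f ln); [exact H | apply derivable_pt_lim_ln; auto].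
  - unfold Rdiv; ring.
Qed.

(** * Absolutely convergent power-sum expansions *)

Section Analytic.
(** To be read with $c=a_{M_N}$ and [n1] $=N$. The radius [rho1] is granted by Assumption A; [rho0]
    exceeds 1 to leave room around $1^N$ and stays below [rho1] to absorb polynomial factors. *)
Variables (c : list nat -> R) (n1 rho0 rho1 Atot : R).
Hypothesis Hn : 1 <= n1.
Hypothesis Hr0 : 1 < rho0.
Hypothesis Hr1 : rho0 < rho1.
Hypothesis HA : infinite_sum
  (fun n => sumR (parts n) (fun mu => Rabs (c mu) * (n1 ^ length mu * rho1 ^ n))) Atot.

Definition sc (phi : list nat -> R) : R :=
  Series (fun n => sumR (parts n) (fun mu => c mu * phi mu)).

Definition dominated C (phi : list nat -> R) : Prop :=
  forall mu, Forall (fun k => (1 <= k)%nat) mu -> Rabs (phi mu) <= C * (n1 ^ length mu * rho1 ^ psize mu).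

Lemma dominated_term C phi n : dominated C phi ->
  Rabs (sumR (parts n) (fun mu => c mu * phi mu)) <=
  C * sumR (parts n) (fun mu => Rabs (c mu) * (n1 ^ length mu * rho1 ^ n)).
Proof.
  intros H. eapply Rle_trans; [apply sumR_abs|]. rewrite <- sumR_scal. apply sumR_le.
  intros mu Hmu. apply parts_spec in Hmu. destruct Hmu as [<- F].
  rewrite Rabs_mult. rewrite (Rmult_comm C), Rmult_assoc, (Rmult_comm _ C).
  apply Rmult_le_compat_l; [apply Rabs_pos | auto].
Qed.

Lemma sc_sum C phi : dominated C phi ->
  infinite_sum (fun n => sumR (parts n) (fun mu => c mu * phi mu)) (sc phi) /\ Rabs (sc phi) <= C * Atot.
Proof.
  intros H.
  destruct (infinite_sum_comp (fun n => sumR (parts n) (fun mu => c mu * phi mu)) _ (C * Atot)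
     (fun n => dominated_term C phi n H)) as [l [Hl Bl]].
  - apply infinite_sum_scal; auto.
  - unfold sc. rewrite (Series_eq _ _ Hl). auto.
Qed.

Lemma dominated_plus C1 C2 f g : dominated C1 f -> dominated C2 g -> dominated (C1 + C2) (fun mu => f mu + g mu).
Proof.
  intros H1 H2 mu F. eapply Rle_trans; [apply Rabs_triang|].
  rewrite Rmult_plus_distr_r. apply Rplus_le_compat; auto.
Qed.

Lemma dominated_scal C a f : dominated C f -> dominated (Rabs a * C) (fun mu => a * f mu).
Proof.
  intros H mu F. rewrite Rabs_mult, Rmult_assoc. apply Rmult_le_compat_l; [apply Rabs_pos | auto].
Qed.

Lemma dominated_zero : dominated 0 (fun _ => 0).
Proof. intros mu F. rewrite Rabs_R0. lra. Qed.

Lemma sc_plus C1 C2 f g : dominated C1 f -> dominated C2 g -> sc (fun mu => f mu + g mu) = sc f + sc g.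
Proof.
  intros H1 H2. apply Series_eq.
  apply (infinite_sum_ext (fun n => sumR (parts n) (fun mu => c mu * f mu) + sumR (parts n) (fun mu => c mu * g mu))).
  - intros n. rewrite <- sumR_plus. apply sumR_ext; intros; ring.
  - apply infinite_sum_plus; eapply sc_sum; eauto.
Qed.

Lemma sc_scal C a f : dominated C f -> sc (fun mu => a * f mu) = a * sc f.
Proof.
  intros H. apply Series_eq.
  apply (infinite_sum_ext (fun n => a * sumR (parts n) (fun mu => c mu * f mu))).
  - intros n. rewrite <- sumR_scal. apply sumR_ext; intros; ring.
  - apply infinite_sum_scal; eapply sc_sum; eauto.
Qed.

Lemma sc_zero : sc (fun _ => 0) = 0.
Proof.
  apply Series_eq. refine (infinite_sum_ext (fun _ => 0) _ _ _ infinite_sum_zero).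
  intros n. symmetry. apply sumR_zero. intros; ring.
Qed.

Lemma dominated_sumR {B} (L : list B) (f : B -> R -> list nat -> R) (T : R -> Prop) :
  (forall b, In b L -> exists C, forall t, T t -> dominated C (f b t)) ->
  exists C, forall t, T t -> dominated C (fun mu => sumR L (fun b => f b t mu)).
Proof.
  induction L as [|b L IH]; intros H; simpl.
  - exists 0. intros; apply dominated_zero.
  - destruct (H b) as [C1 H1]; [left; auto|].
    destruct IH as [C2 H2]; [intros; apply H; right; auto|].
    exists (C1 + C2). intros. apply (dominated_plus C1 C2 (f b t)); auto.
Qed.

Lemma sc_sumR {B} (L : list B) (f : B -> list nat -> R) :
  (forall b, In b L -> exists C, dominated C (f b)) ->
  sc (fun mu => sumR L (fun b => f b mu)) = sumR L (fun b => sc (f b)).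
Proof.
  induction L as [|b L IH]; intros H; simpl; [apply sc_zero|].
  destruct (H b) as [C1 H1]; [left; auto|].
  destruct (dominated_sumR L (fun b _ => f b) (fun _ => True)) as [C2 H2].
  { intros b' Hb. destruct (H b') as [C3 H3]; [right; auto|]. exists C3; auto. }
  rewrite (sc_plus C1 C2 (f b) _ H1 (H2 0 I)).
  rewrite IH; auto. intros; apply H; right; auto.
Qed.

Lemma sc_deriv (phi phi' : R -> list nat -> R) t0 eta C C' :
  0 < eta ->
  (forall t, Rabs (t - t0) < eta -> dominated C (phi t)) ->
  (forall t, Rabs (t - t0) < eta -> dominated C' (phi' t)) ->
  (forall t mu, Rabs (t - t0) < eta -> Forall (fun k => (1 <= k)%nat) mu ->
     derivable_pt_lim (fun s => phi s mu) t (phi' t mu)) ->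
  derivable_pt_lim (fun s => sc (phi s)) t0 (sc (phi' t0)).
Proof.
  intros He H H' HD.
  apply (series_deriv (fun n s => sumR (parts n) (fun mu => c mu * phi s mu))
    (fun n s => sumR (parts n) (fun mu => c mu * phi' s mu))
    (fun n => C' * sumR (parts n) (fun mu => Rabs (c mu) * (n1 ^ length mu * rho1 ^ n)))
    (C' * Atot) _ _ _ eta); auto.
  - apply infinite_sum_scal; auto.
  - intros n t Ht. split; [|apply dominated_term; auto].
    apply (derivable_pt_lim_sumR (parts n) (fun mu s => c mu * phi s mu)).
    intros mu Hmu. apply (derivable_pt_lim_scal (fun s => phi s mu)).
    apply HD; auto. apply (parts_spec n); auto.
  - intros t Ht. eapply sc_sum; eauto.
  - eapply sc_sum. apply H'. rewrite Rminus_diag, Rabs_R0; auto.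
Qed.

Definition TF (vs : list (nat -> R)) (p : nat -> R) : R := sc (dm vs p).
Definition adm (p : nat -> R) : Prop := forall m, (1 <= m)%nat -> Rabs (p m) <= n1 * rho0 ^ m.

(** [C] depends on the number of letters alone, which makes the domination uniform along a curve. *)
Lemma dm_dominated r : exists C, 0 <= C /\ forall K vs p,
  0 <= K -> length vs = r -> adm p -> Forall (bd K rho0) vs -> dominated (K ^ r * C) (dm vs p).
Proof.
  destruct (poly_le_geom r rho0 rho1) as [C [HC H]]; [lra|].
  exists C; split; auto. intros K vs p HK E Hp F mu Fmu. subst r.
  eapply Rle_trans; [apply (dm_bound n1 rho0 K); auto; lra|].
  rewrite Rmult_assoc. apply Rmult_le_compat_l; [apply pow_le; auto|].
  specialize (H (psize mu)).
  replace (INR (psize mu) ^ length vs * (n1 ^ length mu * rho0 ^ psize mu)) with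
    (n1 ^ length mu * (INR (psize mu) ^ length vs * rho0 ^ psize mu)) by ring.
  replace (C * (n1 ^ length mu * rho1 ^ psize mu)) with
    (n1 ^ length mu * (C * rho1 ^ psize mu)) by ring.
  apply Rmult_le_compat_l; auto. apply pow_le; lra.
Qed.

Lemma bd_weaken K K' v : K <= K' -> bd K rho0 v -> bd K' rho0 v.
Proof.
  intros H B m. eapply Rle_trans; [apply B|]. apply Rmult_le_compat_r; auto. apply pow_le; lra.
Qed.

Lemma letters_bounded {A} (V : A -> R -> nat -> R) (T : R -> Prop) S :
  (forall a, In a S -> exists K, forall t, T t -> bd K rho0 (V a t)) ->
  exists K, 0 <= K /\ forall t, T t -> Forall (bd K rho0) (map (fun a => V a t) S).
Proof.
  induction S as [|a S IH]; intros H; simpl.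
  - exists 0; split; [lra | constructor].
  - destruct (H a) as [K1 H1]; [left; auto|].
    destruct IH as [K2 [P2 H2]]; [intros; apply H; right; auto|].
    exists (Rmax K1 K2). split; [eapply Rle_trans; [exact P2 | apply Rmax_r]|].
    intros t Ht. constructor.
    + eapply bd_weaken; [apply Rmax_l | auto].
    + eapply Forall_impl; [|apply (H2 t Ht)]. intros v. apply bd_weaken, Rmax_r.
Qed.

Lemma dm_dominated_family {A} (V : A -> R -> nat -> R) (T : R -> Prop) (pt : R -> nat -> R) S :
  (forall t, T t -> adm (pt t)) ->
  (forall a, In a S -> exists K, forall t, T t -> bd K rho0 (V a t)) ->
  exists C, forall t, T t -> dominated C (dm (map (fun a => V a t) S) (pt t)).
Proof.
  intros Hp HV. destruct (letters_bounded V T S HV) as [K [HK F]].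
  destruct (dm_dominated (length S)) as [C [_ H]].
  exists (K ^ length S * C). intros t Ht. apply H; auto. apply length_map.
Qed.

Lemma TF_deriv {A} (V : A -> R -> nat -> R) (rs : A -> list A) (vel : A) (pt : R -> nat -> R) t0 eta :
  0 < eta ->
  (forall t, Rabs (t - t0) < eta -> adm (pt t)) ->
  (forall t a m, Rabs (t - t0) < eta ->
     derivable_pt_lim (fun s => V a s m) t (sumR (rs a) (fun a' => V a' t m))) ->
  (forall t m, Rabs (t - t0) < eta -> (1 <= m)%nat -> derivable_pt_lim (fun s => pt s m) t (V vel t m)) ->
  (forall a, exists K, forall t, Rabs (t - t0) < eta -> bd K rho0 (V a t)) ->
  forall S, derivable_pt_lim (fun s => TF (map (fun a => V a s) S) (pt s)) t0
    (TF (map (fun a => V a t0) (vel :: S)) (pt t0) +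
     sumR (raises rs S) (fun S' => TF (map (fun a => V a t0) S') (pt t0))).
Proof.
  intros He Hp HV Hd HB S.
  assert (T0 : Rabs (t0 - t0) < eta) by (rewrite Rminus_diag, Rabs_R0; auto).
  set (T := fun t => Rabs (t - t0) < eta).
  assert (HF : forall S', exists C, forall t, T t -> dominated C (dm (map (fun a => V a t) S') (pt t))).
  { intros S'. apply dm_dominated_family; auto. }
  destruct (HF S) as [C0 H0]. destruct (HF (vel :: S)) as [C1 H1].
  destruct (dominated_sumR (raises rs S) (fun S' t => dm (map (fun a => V a t) S') (pt t)) T) as [C2 H2]; auto.
  eapply derivable_pt_lim_eq.
  - apply (sc_deriv (fun t => dm (map (fun a => V a t) S) (pt t))
      (fun t mu => dm (map (fun a => V a t) (vel :: S)) (pt t) mu +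
         sumR (raises rs S) (fun S' => dm (map (fun a => V a t) S') (pt t) mu)) t0 eta C0 (C1 + C2)); auto.
    + intros t Ht. apply (dominated_plus C1 C2 (dm (map (fun a => V a t) (vel :: S)) (pt t))); auto.
    + intros t mu Ht F. apply dm_deriv; auto. intros m Hm. apply Hd; auto.
      rewrite Forall_forall in F; auto.
  - rewrite (sc_plus C1 C2 (dm (map (fun a => V a t0) (vel :: S)) (pt t0))); auto.
    unfold TF. f_equal.
    apply (sc_sumR (raises rs S) (fun S' => dm (map (fun a => V a t0) S') (pt t0))).
    intros S' _. destruct (HF S') as [C3 H3]. exists C3; auto.
Qed.

(** * Derivatives of the logarithm in a coordinate system *)

Section LogDerivatives.
(** A common frame for two coordinate systems. [P] sends coordinates to power sums, and [V a s] is
    the vector named by [a] at [s]. For $p$-coordinates [P] is the identity and letters are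
    constant; for $x$-coordinates [P] is [pxs N] and letters are blocks. *)
Variables (A : Type) (V : A -> (nat -> R) -> nat -> R) (P : (nat -> R) -> nat -> R)
  (vel : nat -> A) (rs : nat -> A -> list A) (ok : nat -> Prop) (Dom : (nat -> R) -> Prop).
Hypothesis Dom_open : forall s i, Dom s -> ok i ->
  exists eta, 0 < eta /\ forall t, Rabs (t - s i) < eta -> Dom (upd s i t).
Hypothesis Dom_adm : forall s, Dom s -> adm (P s).
Hypothesis V_bd : forall a, exists K, forall s, Dom s -> bd K rho0 (V a s).
Hypothesis P_deriv : forall s i m, Dom s -> ok i -> (1 <= m)%nat ->
  derivable_pt_lim (fun t => P (upd s i t) m) (s i) (V (vel i) s m).
Hypothesis V_deriv : forall s i a m, Dom s -> ok i ->
  derivable_pt_lim (fun t => V a (upd s i t) m) (s i) (sumR (rs i a) (fun a' => V a' s m)).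

Definition F0 s := TF [] (P s).
Definition wq s (S : list A) := TF (map (fun a => V a s) S) (P s) / F0 s.

Lemma TF_coord_deriv s i S : Dom s -> ok i ->
  derivable_pt_lim (fun t => TF (map (fun a => V a (upd s i t)) S) (P (upd s i t))) (s i)
    (TF (map (fun a => V a s) (vel i :: S)) (P s) +
     sumR (raises (rs i) S) (fun S' => TF (map (fun a => V a s) S') (P s))).
Proof.
  intros Hs Hi. destruct (Dom_open s i Hs Hi) as [eta [He HD]].
  assert (D := TF_deriv (fun a t => V a (upd s i t)) (rs i) (vel i) (fun t => P (upd s i t)) (s i) eta He).
  cbv beta in D. rewrite upd_same in D. apply D; auto.
  - intros t a m Ht. pose proof (V_deriv (upd s i t) i a m (HD t Ht) Hi) as Q.
    rewrite upd_eq in Q. eapply derivable_pt_lim_near; [exact Rlt_0_1 | | exact Q].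
    intros x _. cbv beta. rewrite upd_upd; auto.
  - intros t m Ht Hm. pose proof (P_deriv (upd s i t) i m (HD t Ht) Hi Hm) as Q.
    rewrite upd_eq in Q. eapply derivable_pt_lim_near; [exact Rlt_0_1 | | exact Q].
    intros x _. cbv beta. rewrite upd_upd; auto.
  - intros a. destruct (V_bd a) as [K HK]. exists K. auto.
Qed.

Lemma F0_coord_deriv s i : Dom s -> ok i ->
  derivable_pt_lim (fun t => F0 (upd s i t)) (s i) (TF [V (vel i) s] (P s)).
Proof.
  intros Hs Hi. eapply derivable_pt_lim_eq; [apply (TF_coord_deriv s i []); auto|]. simpl. ring.
Qed.

Lemma wq_coord_deriv s i S : Dom s -> ok i -> 0 < F0 s ->
  derivable_pt_lim (fun t => wq (upd s i t) S) (s i)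
    (ev (ln (F0 s)) (wq s) (Add (quot (vel i) S) (esum (map Tm (raises (rs i) S))))).
Proof.
  intros Hs Hi Hp.
  pose proof (TF_coord_deriv s i S Hs Hi) as D1. pose proof (F0_coord_deriv s i Hs Hi) as D2.
  eapply derivable_pt_lim_eq.
  - apply (derivable_pt_lim_div _ _ _ _ _ D1 D2). rewrite upd_same. lra.
  - cbv beta. rewrite upd_same. simpl ev. rewrite ev_esum, sumR_map. simpl ev.
    unfold wq at 1 2 3.
    rewrite (sumR_ext (raises (rs i) S) (fun a => wq s a)
      (fun a => / F0 s * TF (map (fun a => V a s) a) (P s))) by (intros; unfold wq, Rdiv; ring).
    rewrite sumR_scal. simpl map. unfold Rsqr. field. lra.
Qed.

(** The next derivative differentiates the formula, so the induction needs it in a neighbourhood of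
    [s] along the coordinate; [Dom_open] and the continuity of $F$ supply one. *)
Lemma pds_ln is : Forall ok is -> forall s, Dom s -> 0 < F0 s ->
  pds is (fun s => ln (F0 s)) s =
  sumR (branch A vel rs is) (fun b => ev (ln (F0 s)) (wq s) (cum b)).
Proof.
  induction is as [|i is IH]; intros Hok s Hs Hp; [simpl; ring|].
  inversion Hok as [|? ? Hi Hok']; subst.
  rewrite <- branch_step. simpl pds. unfold pd. apply Dpt_eq.
  destruct (Dom_open s i Hs Hi) as [eta [He HD]].
  pose proof (F0_coord_deriv s i Hs Hi) as D0.
  destruct (derivable_pt_lim_pos_near _ _ _ D0) as [eta' [He' HF]]; [rewrite upd_same; auto|].
  assert (Hm : 0 < Rmin eta eta') by (apply Rmin_pos; auto).
  apply (derivable_pt_lim_near (fun t => sumR (branch A vel rs is)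
    (fun b => ev (ln (F0 (upd s i t))) (wq (upd s i t)) (cum b))) _ _ _ _ Hm).
  { intros x Hx. symmetry. apply IH; auto.
    - apply HD. eapply Rlt_le_trans; [exact Hx | apply Rmin_l].
    - apply HF. eapply Rlt_le_trans; [exact Hx | apply Rmin_r]. }
  apply (derivable_pt_lim_sumR _ (fun b t => ev (ln (F0 (upd s i t))) (wq (upd s i t)) (cum b))).
  (* The new letter and the raises combine into one derivation, the one that [ev_der] produces for
     this curve. *)
  intros b _. unfold delta, raise_der. rewrite <- ev_der_add.
  pose proof (ev_der (fun t => ln (F0 (upd s i t))) (fun t => wq (upd s i t))
    (Add (Tm [vel i]) (Cst 0)) (fun S => Add (quot (vel i) S) (esum (map Tm (raises (rs i) S)))) (s i)) as Q.
  cbv beta in Q. rewrite upd_same in Q. apply Q.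
  - eapply derivable_pt_lim_eq; [apply derivable_pt_lim_ln_comp; [exact D0 | rewrite upd_same; auto]|].
    cbv beta. rewrite upd_same. simpl. unfold wq. simpl. ring.
  - intros S. apply wq_coord_deriv; auto.
Qed.
End LogDerivatives.

(** * Expanding a letter in unit vectors *)

Definition en (n m : nat) : R := if Nat.eqb m n then 1 else 0.
Definition good (v : nat -> R) : Prop := exists K, bd K rho0 v.

Lemma good_en n : good (en n).
Proof.
  exists 1. intros m. unfold en. pose proof (pow_R1_Rle rho0 m ltac:(lra)).
  destruct (Nat.eqb m n); rewrite ?Rabs_R1, ?Rabs_R0; lra.
Qed.

Lemma good_dominated vs p : Forall good vs -> adm p -> exists C, dominated C (dm vs p).
Proof.
  intros F Hp. destruct (dm_dominated_family (fun v (_ : R) => v) (fun _ => True) (fun _ => p) vs) as [C H]; auto.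
  - intros a Ha. rewrite Forall_forall in F. destruct (F a Ha) as [K HK]. exists K; auto.
  - exists C. specialize (H 0 I). rewrite map_id in H. auto.
Qed.

Lemma Forall_insert S1 S2 (v : nat -> R) : Forall good S1 -> Forall good S2 -> good v -> Forall good (S1 ++ v :: S2).
Proof. intros; apply Forall_app; split; auto. Qed.

Fixpoint good_letters (e : ex (nat -> R)) : Prop :=
  match e with
  | Tm T => Forall good T
  | Add e f | Mul e f => good_letters e /\ good_letters f
  | _ => True
  end.

Lemma good_letters_cum b : Forall good b -> good_letters (cum b).
Proof.
  induction 1 as [|v b Hv Hb IH]; simpl; auto.
  induction (cum b); unfold delta in *; simpl in *; intuition.
Qed.

Section Summation.
Variables (om : nat -> R) (K sg : R).
Hypothesis Hsg : 0 < sg < rho0.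
Hypothesis om0 : om 0%nat = 0.
Hypothesis om_bd : bd K sg om.

Definition tailw n m := if Nat.ltb n m then om m else 0.

Lemma K_pos : 0 <= K.
Proof. pose proof (om_bd 0%nat) as H. simpl in H. pose proof (Rabs_pos (om 0%nat)). lra. Qed.

(** The gap between [sg] and [rho0] makes tails small: for $m>n$,
    $\mathrm{sg}^m\le(\mathrm{sg}/\rho_0)^n\rho_0^m$. *)
Lemma tailw_bd n : bd (K * (sg / rho0) ^ n) rho0 (tailw n).
Proof.
  intros m. unfold tailw. pose proof K_pos as KP.
  assert (Q : 0 < sg / rho0) by (apply Rdiv_lt_0_compat; lra).
  assert (Q1 : sg / rho0 <= 1) by (apply (Rmult_le_reg_r rho0); [lra|]; unfold Rdiv; rewrite Rmult_assoc, Rinv_l; lra).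
  destruct (Nat.ltb_spec n m).
  - eapply Rle_trans; [apply om_bd|].
    replace (sg ^ m) with ((sg / rho0) ^ m * rho0 ^ m).
    2:{ rewrite <- Rpow_mult_distr. f_equal. field. lra. }
    rewrite Rmult_assoc. apply Rmult_le_compat_l; auto.
    apply Rmult_le_compat_r; [apply pow_le; lra|].
    replace m with (n + (m - n))%nat by lia. rewrite pow_add.
    rewrite <- (Rmult_1_r ((sg / rho0) ^ n)) at 2.
    apply Rmult_le_compat_l; [apply pow_le; lra|].
    rewrite <- (pow1 (m - n)). apply pow_incr; lra.
  - rewrite Rabs_R0. repeat apply Rmult_le_pos; auto; apply pow_le; lra.
Qed.

Lemma tailw_0 : tailw 0 = om.
Proof.
  apply functional_extensionality; intros [|m]; unfold tailw; simpl; auto.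
Qed.

Lemma tailw_S n : tailw n = fun m => om (S n) * en (S n) m + tailw (S n) m.
Proof.
  apply functional_extensionality; intros m. unfold tailw, en.
  destruct (Nat.eqb_spec m (S n)); destruct (Nat.ltb_spec n m); destruct (Nat.ltb_spec (S n) m);
    subst; try lia; ring.
Qed.

Lemma tailw_good n : good (tailw n).
Proof. exists (K * (sg / rho0) ^ n). apply tailw_bd. Qed.

Lemma TF_tail_step S1 S2 p n : Forall good S1 -> Forall good S2 -> adm p ->
  TF (S1 ++ tailw n :: S2) p = om (S n) * TF (S1 ++ en (S n) :: S2) p + TF (S1 ++ tailw (S n) :: S2) p.
Proof.
  intros F1 F2 Hp. unfold TF.
  destruct (good_dominated (S1 ++ en (S n) :: S2) p) as [C1 D1]; auto using Forall_insert, good_en.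
  destruct (good_dominated (S1 ++ tailw (S n) :: S2) p) as [C2 D2]; auto using Forall_insert, tailw_good.
  rewrite <- (sc_scal _ _ _ D1).
  rewrite <- (sc_plus _ _ _ _ (dominated_scal _ (om (S n)) _ D1) D2).
  f_equal. apply functional_extensionality; intros mu. rewrite (tailw_S n). apply dm_linear.
Qed.

Lemma TF_tail_small S1 S2 p : Forall good S1 -> Forall good S2 -> adm p ->
  Un_cv (fun n => TF (S1 ++ tailw n :: S2) p) 0.
Proof.
  intros F1 F2 Hp.
  set (q := sg / rho0).
  assert (Q : 0 < q) by (apply Rdiv_lt_0_compat; lra).
  assert (Q1 : q < 1) by (apply (Rmult_lt_reg_r rho0); [lra|]; unfold q, Rdiv; rewrite Rmult_assoc, Rinv_l; lra).
  (* The rescaled tails obey one bound for all [n], so linearity in this letter extracts the factor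
     $q^n$ from a uniformly bounded quantity. *)
  set (u := fun n m => / q ^ n * tailw n m).
  assert (qn : forall n, 0 < q ^ n) by (intros; apply pow_lt; auto).
  assert (ub : forall n, bd K rho0 (u n)).
  { intros n m. unfold u. rewrite Rabs_mult, Rabs_inv, (Rabs_pos_eq (q ^ n)) by (apply Rlt_le; auto).
    apply (Rmult_le_reg_l (q ^ n)); auto. rewrite <- Rmult_assoc, Rinv_r by (apply Rgt_not_eq, qn). rewrite Rmult_1_l.
    eapply Rle_trans; [apply tailw_bd|]. fold q. lra. }
  assert (FK : exists K', 0 <= K' /\ Forall (bd K' rho0) (S1 ++ S2)).
  { destruct (letters_bounded (fun v (_ : R) => v) (fun _ => True) (S1 ++ S2)) as [K' [P' H']].
    - intros a Ha. assert (F : Forall good (S1 ++ S2)) by (apply Forall_app; auto).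
      rewrite Forall_forall in F. destruct (F a Ha) as [K' HK]. exists K'; auto.
    - exists K'; split; auto. specialize (H' 0 I). rewrite map_id in H'. auto. }
  destruct FK as [K' [P' F']].
  set (KK := Rmax K K').
  assert (KKp : 0 <= KK) by (eapply Rle_trans; [exact P' | apply Rmax_r]).
  assert (FF : forall n, Forall (bd KK rho0) (S1 ++ u n :: S2)).
  { intros n. apply Forall_app in F'. destruct F' as [F3 F4].
    apply Forall_app; split; [|constructor].
    - eapply Forall_impl; [|exact F3]. intros v; apply bd_weaken, Rmax_r.
    - eapply bd_weaken; [apply Rmax_l | apply ub].
    - eapply Forall_impl; [|exact F4]. intros v; apply bd_weaken, Rmax_r. }
  destruct (dm_dominated (length (S1 ++ om :: S2))) as [C [PC HC]].
  set (B := KK ^ length (S1 ++ om :: S2) * C * Atot).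
  assert (E : forall n, Rabs (TF (S1 ++ tailw n :: S2) p) <= q ^ n * B).
  { intros n. assert (D : dominated (KK ^ length (S1 ++ om :: S2) * C) (dm (S1 ++ u n :: S2) p)).
    { apply HC; auto. rewrite !length_app; auto. }
    replace (TF (S1 ++ tailw n :: S2) p) with (q ^ n * TF (S1 ++ u n :: S2) p).
    - rewrite Rabs_mult, (Rabs_pos_eq (q ^ n)) by (apply Rlt_le; auto).
      apply Rmult_le_compat_l; [apply Rlt_le; auto|]. apply sc_sum; auto.
    - unfold TF. rewrite <- (sc_scal _ _ _ D). f_equal.
      apply functional_extensionality; intros mu.
      pose proof (dm_linear S1 S2 (q ^ n) (u n) (fun _ => 0) p mu) as L1.
      (* This instance reads $d=d+d$ for the zero letter, so its value is 0 and [L1] becomes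
         homogeneity. *)
      pose proof (dm_linear S1 S2 1 (fun _ => 0) (fun _ => 0) p mu) as L2.
      cbv beta in L1, L2.
      replace (fun _ : nat => 1 * 0 + 0) with (fun _ : nat => 0) in L2
        by (apply functional_extensionality; intros; ring).
      replace (tailw n) with (fun m => q ^ n * u n m + 0); [lra|].
      apply functional_extensionality; intros m. unfold u.
      rewrite <- Rmult_assoc, Rinv_r by (apply Rgt_not_eq, qn). ring. }
  assert (BP : 0 <= B).
  { specialize (E 0%nat). simpl in E. pose proof (Rabs_pos (TF (S1 ++ tailw 0 :: S2) p)). lra. }
  intros eps He.
  destruct (pow_lt_1_zero q) with (y := eps / (B + 1)) as [n0 H0].
  - rewrite Rabs_pos_eq; lra.
  - apply Rdiv_lt_0_compat; lra.
  - exists n0. intros n Hnn. unfold Rdist. rewrite Rminus_0_r.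
    eapply Rle_lt_trans; [apply E|]. specialize (H0 n Hnn).
    rewrite Rabs_pos_eq in H0 by (apply Rlt_le; auto).
    apply (Rmult_lt_compat_r (B + 1)) in H0; [|lra].
    unfold Rdiv in H0. rewrite Rmult_assoc, Rinv_l in H0 by lra.
    specialize (qn n). nra.
Qed.

(** Peeling off the entries of [om] one by one telescopes: a partial sum is the value at [om] minus
    the value at the tail. *)
Lemma TF_weight_sum S1 S2 p : Forall good S1 -> Forall good S2 -> adm p ->
  infinite_sum (fun j => om (S j) * TF (S1 ++ en (S j) :: S2) p) (TF (S1 ++ om :: S2) p).
Proof.
  intros F1 F2 Hp.
  assert (E : forall n, sum_f_R0 (fun j => om (S j) * TF (S1 ++ en (S j) :: S2) p) n =
    TF (S1 ++ om :: S2) p - TF (S1 ++ tailw (S n) :: S2) p).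
  { induction n as [|n IH].
    - simpl. pose proof (TF_tail_step S1 S2 p 0 F1 F2 Hp) as Q. rewrite tailw_0 in Q. lra.
    - simpl. rewrite IH. pose proof (TF_tail_step S1 S2 p (S n) F1 F2 Hp) as Q. lra. }
  change (Un_cv (sum_f_R0 (fun j => om (S j) * TF (S1 ++ en (S j) :: S2) p)) (TF (S1 ++ om :: S2) p)).
  apply (Un_cv_ext_from 0 (fun n => TF (S1 ++ om :: S2) p - TF (S1 ++ tailw (S n) :: S2) p)); [auto|].
  rewrite <- (Rminus_0_r (TF (S1 ++ om :: S2) p)) at 1.
  apply CV_minus.
  - intros e He; exists 0%nat; intros; rewrite R_dist_eq; auto.
  - pose proof (CV_shift' _ 1 _ (TF_tail_small S1 S2 p F1 F2 Hp)) as Q.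
    apply (Un_cv_ext_from 0) with (2 := Q). intros n _. cbv beta. rewrite Nat.add_1_r. auto.
Qed.

(* E depends linearly on a letter: replacing that letter by the unit vectors
   [en n] and summing against om gives e. *)
Inductive linear_in : (nat -> ex (nat -> R)) -> ex (nat -> R) -> Prop :=
| lin_zero : linear_in (fun _ => Cst 0) (Cst 0)
| lin_Tm S1 S2 : Forall good S1 -> Forall good S2 ->
    linear_in (fun n => Tm (S1 ++ en n :: S2)) (Tm (S1 ++ om :: S2))
| lin_Add E1 e1 E2 e2 : linear_in E1 e1 -> linear_in E2 e2 ->
    linear_in (fun n => Add (E1 n) (E2 n)) (Add e1 e2)
| lin_Mul_l E1 e1 f : linear_in E1 e1 -> linear_in (fun n => Mul (E1 n) f) (Mul e1 f)
| lin_Mul_r E1 e1 f : linear_in E1 e1 -> linear_in (fun n => Mul f (E1 n)) (Mul f e1).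

Lemma linear_in_delta v E1 e1 : good v -> linear_in E1 e1 ->
  linear_in (fun n => delta v (E1 n)) (delta v e1).
Proof.
  intros Hv; induction 1; unfold delta in *; simpl.
  - constructor.
  - apply lin_Add; [apply (lin_Tm (v :: S1) S2); auto|].
    apply lin_Mul_r, lin_Mul_l, lin_Tm; auto.
  - apply lin_Add; auto.
  - apply lin_Add; [apply lin_Mul_l | apply lin_Mul_l]; auto.
  - apply lin_Add; [apply lin_Mul_r | apply lin_Mul_r]; auto.
Qed.

Lemma linear_in_head e : good_letters e -> linear_in (fun n => delta (en n) e) (delta om e).
Proof.
  induction e; unfold delta in *; simpl; intros G.
  - constructor.
  - apply (lin_Tm [] []); auto.
  - apply lin_Add; [apply (lin_Tm [] S); auto|].
    apply lin_Mul_r, lin_Mul_r, (lin_Tm [] []); auto.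
  - apply lin_Add; [apply IHe1, G | apply IHe2, G].
  - apply lin_Add; [apply lin_Mul_l, IHe1, G | apply lin_Mul_r, IHe2, G].
Qed.

Lemma linear_in_cum S1 S2 : Forall good S1 -> Forall good S2 ->
  linear_in (fun n => cum (S1 ++ en n :: S2)) (cum (S1 ++ om :: S2)).
Proof.
  intros F1 F2. induction F1; simpl.
  - apply linear_in_head, good_letters_cum; auto.
  - apply linear_in_delta; auto.
Qed.

Lemma linear_in_sum p l E1 e1 : adm p -> linear_in E1 e1 ->
  infinite_sum (fun j => om (S j) * ev l (fun S => TF S p / TF [] p) (E1 (S j)))
    (ev l (fun S => TF S p / TF [] p) e1).
Proof.
  intros Hp; induction 1; simpl.
  - refine (infinite_sum_ext (fun _ => 0) _ _ _ infinite_sum_zero). intros; ring.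
  - pose proof (infinite_sum_scal _ _ (/ TF [] p) (TF_weight_sum S1 S2 p H H0 Hp)) as Q.
    unfold Rdiv. rewrite Rmult_comm. eapply infinite_sum_ext; [|exact Q]. intros; simpl; ring.
  - eapply infinite_sum_ext; [|apply (infinite_sum_plus _ _ _ _ IHlinear_in1 IHlinear_in2)].
    intros; simpl; ring.
  - rewrite Rmult_comm.
    eapply infinite_sum_ext; [|apply (infinite_sum_scal _ _ _ IHlinear_in)]. intros; simpl; ring.
  - eapply infinite_sum_ext; [|apply (infinite_sum_scal _ _ _ IHlinear_in)]. intros; simpl; ring.
Qed.
End Summation.

(* [om 0 = 0] because the sums over p-indices start at 1. *)
Definition weight (om : nat -> R) : Prop :=
  om 0%nat = 0 /\ exists K sg, 0 < sg < rho0 /\ bd K sg om.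

Lemma weight_good om : weight om -> good om.
Proof.
  intros [H0 [K [sg [Hs Hb]]]]. pose proof (tailw_good om K sg Hs Hb 0) as G.
  rewrite tailw_0 in G; auto.
Qed.

Lemma cum_weight_sum om p l S1 S2 : weight om -> adm p -> Forall good S1 -> Forall good S2 ->
  infinite_sum (fun j => om (S j) * ev l (fun S => TF S p / TF [] p) (cum (S1 ++ en (S j) :: S2)))
    (ev l (fun S => TF S p / TF [] p) (cum (S1 ++ om :: S2))).
Proof.
  intros [H0 [K [sg [Hs Hb]]]] Hp F1 F2.
  apply (linear_in_sum om K sg Hs H0 Hb p l (fun n => cum (S1 ++ en n :: S2))); auto.
  apply linear_in_cum; auto.
Qed.

Definition wprod (is : list nat) (oms : list (nat -> R)) : R :=
  prodR (combine is oms) (fun io => snd io (fst io)).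

(** The nested series are summed from the inside out: [S1] collects the unit vectors of the outer
    indices, still fixed, while the inner letters have already become weights. *)
Lemma msum_cum p l oms : adm p -> Forall weight oms -> forall f C S1, Forall good S1 ->
  (forall is, length is = length oms ->
     f is = C * wprod is oms * ev l (fun S => TF S p / TF [] p) (cum (S1 ++ map en is))) ->
  msum (length oms) f = C * ev l (fun S => TF S p / TF [] p) (cum (S1 ++ oms)).
Proof.
  intros Hp FW; induction FW as [|om oms Hw FW IH]; intros f C S1 F1 Hf.
  - simpl. rewrite Hf by auto. unfold wprod; simpl. ring.
  - simpl. apply Series_eq.
    apply (infinite_sum_ext (fun j => C * (om (S j) *
       ev l (fun S => TF S p / TF [] p) (cum (S1 ++ en (S j) :: oms))))).
    + intros j. rewrite (IH (fun is => f (S j :: is)) (C * om (S j)) (S1 ++ [en (S j)])).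
      * rewrite <- app_assoc. simpl. ring.
      * apply Forall_app; auto using good_en.
      * intros is Hl. rewrite Hf by (simpl; auto). unfold wprod. simpl. rewrite <- app_assoc. simpl. ring.
    + apply infinite_sum_scal. apply cum_weight_sum; auto.
      eapply Forall_impl; [|exact FW]. apply weight_good.
Qed.
End Analytic.

(** * Falling factorials and power sums *)

(** The falling factorial $(m)_k$. Truncated subtraction is harmless: for $k>m$ the product already
    contains the factor $m-m$. *)
Fixpoint ff (k m : nat) : R :=
  match k with
  | O => 1
  | S k => ff k m * INR (m - k)
  end.

Lemma ff_binomR k m : ff k m = INR (fact k) * binomR m k.
Proof.
  unfold binomR. destruct (Nat.leb_spec k m) as [H|H].
  - unfold Binomial.C. enough (E : ff k m * INR (fact (m - k)) = INR (fact m)).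
    { rewrite <- E. field. split; apply INR_fact_neq_0. }
    induction k as [|k IH]; [simpl; rewrite Nat.sub_0_r; ring|].
    rewrite <- IH by lia. simpl ff. replace (m - k)%nat with (S (m - S k)) by lia.
    rewrite fact_simpl, mult_INR. ring.
  - rewrite Rmult_0_r. induction k as [|k IH]; [lia|]. simpl.
    destruct (Nat.eq_dec k m) as [->|]; [rewrite Nat.sub_diag; simpl; ring|].
    rewrite IH by lia. ring.
Qed.

Lemma ff_pos_bound k m : 0 <= ff k m <= INR m ^ k.
Proof.
  induction k as [|k IH]; simpl; [lra|].
  pose proof (pos_INR (m - k)). assert (INR (m - k) <= INR m) by (apply le_INR; lia).
  pose proof (pos_INR m).
  split; [apply Rmult_le_pos; lra|].
  rewrite (Rmult_comm (INR m)). apply Rmult_le_compat; lra.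
Qed.

Lemma ff_0 k : (1 <= k)%nat -> ff k 0 = 0.
Proof. destruct k as [|k]; intros; [lia|]. simpl. ring. Qed.

Lemma weight_ff rho0 k : 1 < rho0 -> (1 <= k)%nat -> weight rho0 (ff k).
Proof.
  intros Hr Hk. split; [apply ff_0; auto|].
  destruct (poly_le_geom k 1 ((1 + rho0) / 2)) as [C [_ HC]]; [lra|].
  exists C, ((1 + rho0) / 2). split; [lra|]. intros m.
  destruct (ff_pos_bound k m). rewrite Rabs_pos_eq by auto.
  eapply Rle_trans; [eassumption|]. specialize (HC m). rewrite pow1 in HC. lra.
Qed.

Lemma weight_binom rho0 k : 1 < rho0 -> (1 <= k)%nat -> weight rho0 (fun m => binomR m k).
Proof.
  intros Hr Hk. destruct (weight_ff rho0 k Hr Hk) as [H0 [K [sg [Hs Hb]]]].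
  pose proof (INR_fact_lt_0 k) as Fp.
  assert (E : forall m, binomR m k = / INR (fact k) * ff k m).
  { intros m. rewrite ff_binomR. field. lra. }
  split; [rewrite E, H0; ring|]. exists (/ INR (fact k) * K), sg. split; auto.
  intros m. rewrite E, Rabs_mult, Rabs_inv, (Rabs_pos_eq (INR (fact k))) by lra.
  rewrite Rmult_assoc. apply Rmult_le_compat_l; [apply Rlt_le, Rinv_0_lt_compat; auto | apply Hb].
Qed.

(** For a block $(i,k)$ with $k\ge1$ this is $\partial_i^k p_m$; where $m<k$ the truncated exponent
    is multiplied by 0. *)
Definition blockw (a : nat * nat) (x : nat -> R) (m : nat) : R := ff (snd a) m * x (fst a) ^ (m - snd a).

Lemma upd_pow_deriv x i j n :
  derivable_pt_lim (fun t => upd x i t j ^ n) (x i) (if Nat.eqb j i then INR n * x i ^ pred n else 0).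
Proof.
  unfold upd. destruct (Nat.eqb j i).
  - apply derivable_pt_lim_pow.
  - apply derivable_pt_lim_const.
Qed.

Lemma blockw_deriv x i a m :
  derivable_pt_lim (fun t => blockw a (upd x i t) m) (x i) (sumR (block_raise i a) (fun a' => blockw a' x m)).
Proof.
  destruct a as [j k]. unfold blockw, block_raise. simpl.
  eapply derivable_pt_lim_eq.
  - apply (derivable_pt_lim_scal (fun t => upd x i t j ^ (m - k))). apply upd_pow_deriv.
  - rewrite Nat.eqb_sym. destruct (Nat.eqb_spec i j) as [->|]; simpl; [|ring].
    replace (m - S k)%nat with (pred (m - k)) by lia. ring.
Qed.

Lemma sumR_single (l : list nat) i c : NoDup l -> In i l ->
  sumR l (fun j => if Nat.eqb j i then c else 0) = c.
Proof.
  induction l as [|a l IH]; intros ND H; [destruct H|].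
  inversion ND as [|? ? NI ND']; subst. simpl.
  destruct (Nat.eqb_spec a i) as [->|Hne].
  - rewrite sumR_zero; [ring|]. intros j Hj. destruct (Nat.eqb_spec j i); auto. subst; tauto.
  - rewrite IH; auto; [ring|]. destruct H; [congruence | auto].
Qed.

Lemma pxs_deriv N x i m : (1 <= i <= N)%nat ->
  derivable_pt_lim (fun t => pxs N (upd x i t) m) (x i) (blockw (i, 1%nat) x m).
Proof.
  intros H. unfold pxs. eapply derivable_pt_lim_eq.
  - apply (derivable_pt_lim_sumR (seq 1 N) (fun j t => upd x i t j ^ m)). intros j _. apply upd_pow_deriv.
  - cbv beta. rewrite sumR_single; [|apply seq_NoDup | apply in_seq; lia].
    unfold blockw. simpl. rewrite Nat.sub_0_r. replace (m - 1)%nat with (pred m) by lia. ring.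
Qed.

Lemma pxs_one N : pxs N xone = pone N.
Proof.
  apply functional_extensionality; intros m. unfold pxs, pone, xone.
  rewrite (sumR_ext _ _ (fun _ => 1)) by (intros; apply pow1).
  rewrite sumR_const, length_seq. ring.
Qed.

Lemma blockw_one a : blockw a xone = ff (snd a).
Proof. apply functional_extensionality; intros m. unfold blockw, xone. rewrite pow1. ring. Qed.

(** * The generating function *)

(** The convention for [ln] settles the degenerate case of an identically zero $F_N$: both
    logarithms are then the zero function. *)
Lemma ln_0 : ln 0 = 0.
Proof. unfold ln. destruct (Rlt_dec 0 0) as [h|]; auto. exfalso; lra. Qed.

(** [Jp] expands $J_\lambda$ over partitions of $|\lambda|$ only, so in each degree the exchange
    concerns finite sums. *)
Lemma FN_term J M N p n :
  sumR (YN N n) (fun lam => M N lam * Jp J lam p / J1 J lam N) =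
  sumR (parts n) (fun mu => aM J M N mu * dm [] p mu).
Proof.
  transitivity (sumR (YN N n) (fun lam => sumR (parts n) (fun mu =>
     (M N lam * J lam mu / J1 J lam N) * pprod mu p))).
  - apply sumR_ext. intros lam Hl. unfold YN in Hl. apply filter_In in Hl.
    destruct Hl as [Hl _]. apply parts_spec in Hl. destruct Hl as [Hl _].
    unfold Jp. rewrite Hl. unfold Rdiv. rewrite (Rmult_comm (M N lam)), Rmult_assoc, Rmult_comm, <- sumR_scal.
    apply sumR_ext; intros; ring.
  - rewrite sumR_swap. apply sumR_ext. intros mu Hm. apply parts_spec in Hm. destruct Hm as [Hm _].
    unfold aM. rewrite Hm. simpl. rewrite Rmult_comm, <- sumR_scal. apply sumR_ext; intros; ring.
Qed.

Lemma FN_TF J M N p : FN J M N p = TF (aM J M N) [] p.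
Proof.
  unfold FN, TF, sc. f_equal. apply functional_extensionality; intros n. apply FN_term.
Qed.

(* If no lambda of positive mass has J_lambda(1^N) <> 0 then every term of F_N
   is 0, because division by 0 gives 0; this replaces the nonvanishing of
   J_lambda(1^N) for Jack functions. *)
Lemma FN_zero_or_pos J M N : IsProbY (M N) N ->
  (exists l, infinite_sum (fun n => sumR (YN N n) (fun lam => M N lam * Jp J lam (pone N) / J1 J lam N)) l) ->
  (forall p, FN J M N p = 0) \/ 0 < FN J M N (pone N).
Proof.
  intros [Hp _] [l Hl].
  assert (T : forall n lam, In lam (YN N n) -> 0 <= M N lam * Jp J lam (pone N) / J1 J lam N).
  { intros n lam H. unfold J1. specialize (Hp n lam H).
    destruct (Req_dec (Jp J lam (pone N)) 0) as [E|E].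
    - rewrite E. unfold Rdiv. rewrite Rmult_0_r, Rmult_0_l. lra.
    - replace (M N lam * Jp J lam (pone N) / Jp J lam (pone N)) with (M N lam) by (field; auto). auto. }
  destruct (classic (exists n lam, In lam (YN N n) /\ M N lam <> 0 /\ J1 J lam N <> 0)) as [[n [lam [H [H1 H2]]]]|H].
  - right.
    assert (E : FN J M N (pone N) = l) by (apply Series_eq; auto).
    rewrite E. set (u := fun n => sumR (YN N n) (fun lam => M N lam * Jp J lam (pone N) / J1 J lam N)) in *.
    assert (U : forall n, 0 <= u n).
    { intros k. unfold u. rewrite <- (sumR_zero (YN N k) (fun _ => 0)) by auto. apply sumR_le.
      intros; eapply T; eauto. }
    assert (Un : 0 < u n).
    { unfold u. apply in_split in H as H'. destruct H' as [l1 [l2 E']].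
      rewrite E', sumR_app. simpl.
      assert (0 <= sumR l1 (fun lam => M N lam * Jp J lam (pone N) / J1 J lam N)).
      { rewrite <- (sumR_zero l1 (fun _ => 0)) by auto. apply sumR_le. intros a Ha.
        apply (T n). rewrite E'. apply in_or_app; auto. }
      assert (0 <= sumR l2 (fun lam => M N lam * Jp J lam (pone N) / J1 J lam N)).
      { rewrite <- (sumR_zero l2 (fun _ => 0)) by auto. apply sumR_le. intros a Ha.
        apply (T n). rewrite E'. apply in_or_app; simpl; auto. }
      assert (0 < M N lam * Jp J lam (pone N) / J1 J lam N); [|lra].
      unfold J1 in *. replace (M N lam * Jp J lam (pone N) / Jp J lam (pone N)) with (M N lam) by (field; auto).
      specialize (Hp n lam H). lra. }
    eapply Rlt_le_trans; [exact Un|].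
    eapply Rle_trans; [|apply (sum_incr u n l Hl U)].
    destruct n; simpl; [lra|].
    assert (0 <= sum_f_R0 u n) by (apply cond_pos_sum; auto). lra.
  - left. intros p. apply Series_eq. refine (infinite_sum_ext (fun _ => 0) _ _ _ infinite_sum_zero).
    intros n. symmetry. apply sumR_zero. intros lam Hlam.
    destruct (Req_dec (M N lam) 0) as [E|E]; [rewrite E; unfold Rdiv; ring|].
    destruct (Req_dec (J1 J lam N) 0) as [E'|E'].
    + rewrite E'. unfold Rdiv. rewrite Rinv_0. ring.
    + exfalso; apply H; eauto.
Qed.

Lemma pds_zero is : pds is (fun _ => 0) = fun _ => 0.
Proof.
  induction is as [|i is IH]; simpl; auto. rewrite IH. apply functional_extensionality; intros p.
  apply Dpt_eq, derivable_pt_lim_const.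
Qed.

Lemma msum_ext r : forall f g, (forall is, length is = r -> f is = g is) -> msum r f = msum r g.
Proof.
  induction r as [|r IH]; intros f g H; simpl; [apply H; auto|].
  f_equal. apply functional_extensionality; intros j. apply IH. intros is Hl. apply H; simpl; auto.
Qed.

Lemma msum_zero r : msum r (fun _ => 0) = 0.
Proof.
  induction r as [|r IH]; simpl; auto. rewrite IH. apply Series_eq, infinite_sum_zero.
Qed.

Lemma wprod_binom ks : forall is, wprod is (map (fun k m => binomR m k) ks) = prodbinom is ks.
Proof.
  unfold wprod, prodbinom. induction ks as [|k ks IH]; intros [|i is]; simpl; auto. rewrite IH; auto.
Qed.

Lemma wprod_ff ks : forall is, length is = length ks ->
  wprod is (map ff ks) = prodR ks (fun k => INR (fact k)) * prodbinom is ks.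
Proof.
  unfold wprod, prodbinom. induction ks as [|k ks IH]; intros [|i is] H; simpl in *; try discriminate; [ring|].
  rewrite IH by auto. rewrite ff_binomR. ring.
Qed.

(** The sum $L(k_1,\dots,k_r)$. The factorials stay outside, so that the inner [msum] is literally
    the one in the vanishing conditions. *)
Definition Lsum J M (N : nat) (ks : list nat) : R :=
  prodR ks (fun k => INR (fact k)) *
  msum (length ks) (fun is => prodbinom is ks * pds is (lnF J M N) (pone N)).

Lemma raises_none {A} (b : list A) : raises (fun _ => []) b = [].
Proof. induction b; simpl; auto. rewrite IHb; auto. Qed.

Lemma branch_none {A} (vel : nat -> A) is : branch A vel (fun _ _ => []) is = [map vel is].
Proof. induction is; simpl; auto. rewrite IHis. simpl. rewrite raises_none; auto. Qed.

(** * Both families of derivatives at a fixed N *)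

Section FixedN.
Variables (J : list nat -> list nat -> R) (M : nat -> list nat -> R) (N : nat).
Hypothesis HN : (1 <= N)%nat.
Hypothesis HM : IsProbY (M N) N.
Hypothesis HA : AssumptionA J M.

Lemma summable : exists rho1 Atot, 1 < rho1 /\ infinite_sum
  (fun n => sumR (parts n) (fun mu => Rabs (aM J M N mu) * (INR N ^ length mu * rho1 ^ n))) Atot.
Proof.
  destruct HA as [eps [He H]]. destruct (H N (1 + eps / 2)) as [l Hl].
  - rewrite Rabs_pos_eq; lra.
  - exists (1 + eps / 2), l. split; [lra|].
    rewrite (Rabs_pos_eq (1 + eps / 2)) in Hl by lra.
    eapply infinite_sum_ext; [|exact Hl]. intros n. apply sumR_ext; intros; cbv beta; ring.
Qed.

Lemma INR_N : 1 <= INR N.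
Proof. apply (le_INR 1); auto. Qed.

Let cf := aM J M N.

Lemma FN_dichotomy : (forall p, FN J M N p = 0) \/ 0 < TF cf [] (pone N).
Proof.
  unfold cf. rewrite <- FN_TF. apply FN_zero_or_pos; auto.
  destruct summable as [rho1 [Atot [Hr Hs]]].
  assert (D : dominated (INR N) rho1 1 (dm [] (pone N))).
  { intros mu F. rewrite Rmult_1_l. apply pprod_bound; auto; try lra.
    - pose proof INR_N; lra.
    - intros m _. unfold pone. pose proof INR_N. rewrite Rabs_pos_eq by lra.
      rewrite <- (Rmult_1_r (INR N)) at 1. apply Rmult_le_compat_l; [lra|]. apply pow_R1_Rle; lra. }
  destruct (sc_sum cf (INR N) rho1 Atot Hs 1 _ D) as [S _].
  exists (sc cf (dm [] (pone N))).
  eapply infinite_sum_ext; [|exact S]. intros n. cbv beta.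
  symmetry. apply FN_term.
Qed.

Section Zero.
Hypothesis FN0 : forall p, FN J M N p = 0.

Lemma lnF_zero : lnF J M N = fun _ => 0.
Proof. apply functional_extensionality; intros p. unfold lnF. rewrite FN0. apply ln_0. Qed.

Lemma Psi_zero : Psi J M N = fun _ => 0.
Proof. apply functional_extensionality; intros p. unfold Psi, FxN. rewrite FN0. apply ln_0. Qed.

Lemma Lsum_zero ks : Lsum J M N ks = 0.
Proof.
  unfold Lsum. rewrite lnF_zero, (msum_ext _ _ (fun _ => 0)).
  - rewrite msum_zero. ring.
  - intros is _. rewrite pds_zero. ring.
Qed.
End Zero.

Section Positive.
Hypothesis Fpos : 0 < TF cf [] (pone N).

(** The common currency of the two sides: a logarithmic derivative of $F_N$ at $1^N$ along arbitrary
    vectors, including those that move infinitely many $p_n$. *)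
Definition evw (b : list (nat -> R)) : R :=
  ev (ln (TF cf [] (pone N))) (fun S => TF cf S (pone N) / TF cf [] (pone N)) (cum b).

Section Radii.
Variables (rho0 rho1 Atot : R).
Hypothesis Hr0 : 1 < rho0.
Hypothesis Hr1 : rho0 < rho1.
Hypothesis Hs : infinite_sum
  (fun n => sumR (parts n) (fun mu => Rabs (cf mu) * (INR N ^ length mu * rho1 ^ n))) Atot.

Lemma pone_lt m : (1 <= m)%nat -> Rabs (pone N m) < INR N * rho0 ^ m.
Proof.
  intros Hm. unfold pone. pose proof INR_N. rewrite Rabs_pos_eq by lra.
  rewrite <- (Rmult_1_r (INR N)) at 1. apply Rmult_lt_compat_l; [lra|].
  apply Rlt_pow_R1; auto; lia.
Qed.

Lemma pone_adm : adm (INR N) rho0 (pone N).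
Proof. intros m Hm. apply Rlt_le, pone_lt; auto. Qed.

Lemma pds_lnF is : pds is (lnF J M N) (pone N) = evw (map en is).
Proof.
  replace (lnF J M N) with (fun p => ln (F0 cf (fun p => p) p)).
  2:{ apply functional_extensionality; intros p. unfold lnF, F0. rewrite FN_TF; auto. }
  (* The domain imposes infinitely many strict inequalities, yet it is open along each single
     coordinate. Unit vectors are constant, so nothing is raised and one branch remains. *)
  rewrite (pds_ln cf (INR N) rho0 rho1 Atot INR_N Hr0 Hr1 Hs nat (fun n _ => en n) (fun p => p)
    (fun i => i) (fun _ _ => []) (fun _ => True)
    (fun p => forall m, (1 <= m)%nat -> Rabs (p m) < INR N * rho0 ^ m)).
  - rewrite branch_none, map_id. simpl. rewrite Rplus_0_r. unfold evw.
    rewrite <- ev_cum_map. auto.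
  - intros p i Hp _.
    destruct (le_lt_dec 1 i) as [Hi|Hi].
    + exists (INR N * rho0 ^ i - Rabs (p i)). split; [specialize (Hp i Hi); lra|].
      intros t Ht m Hm. unfold upd. destruct (Nat.eqb_spec m i) as [->|]; auto.
      replace t with ((t - p i) + p i) by ring.
      eapply Rle_lt_trans; [apply Rabs_triang|]. lra.
    + exists 1. split; [lra|]. intros t Ht m Hm. unfold upd. destruct (Nat.eqb_spec m i); [lia|auto].
  - intros p Hp m Hm. apply Rlt_le; auto.
  - intros n. destruct (good_en rho0 Hr0 n) as [K HK]. exists K; auto.
  - intros p i m _ _ _. unfold upd, en. destruct (Nat.eqb m i).
    + apply derivable_pt_lim_id.
    + apply derivable_pt_lim_const.
  - intros. simpl. apply derivable_pt_lim_const.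
  - apply Forall_forall; auto.
  - apply pone_lt.
  - auto.
Qed.

Lemma msum_evw oms f C : Forall (weight rho0) oms ->
  (forall is, length is = length oms -> f is = C * wprod is oms * pds is (lnF J M N) (pone N)) ->
  msum (length oms) f = C * evw oms.
Proof.
  intros Hw Hf.
  apply (msum_cum cf (INR N) rho0 rho1 Atot INR_N Hr0 Hr1 Hs (pone N) (ln (TF cf [] (pone N))) oms
    pone_adm Hw f C []); [constructor|].
  intros is Hl. rewrite Hf, pds_lnF; auto.
Qed.

Lemma weights_ff ks : pos ks -> Forall (weight rho0) (map ff ks).
Proof. intros F. apply Forall_map. eapply Forall_impl; [|exact F]. intros; apply weight_ff; auto. Qed.

Lemma msum_ff f ks : pos ks ->
  (forall is, length is = length ks ->
     f is = prodR ks (fun k => INR (fact k)) * prodbinom is ks * pds is (lnF J M N) (pone N)) ->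
  msum (length ks) f = evw (map ff ks).
Proof.
  intros F Hf. rewrite <- (length_map ff ks), <- (Rmult_1_l (evw _)). apply msum_evw.
  - apply weights_ff; auto.
  - intros is Hl. rewrite length_map in Hl. rewrite Hf, wprod_ff by auto. ring.
Qed.

(** [Series] is arbitrary on divergent input, so the factorials cannot simply be moved through
    [msum]; both forms are instead computed as multiples of the cumulant with binomial letters. *)
Lemma Lsum_evw ks : pos ks -> Lsum J M N ks = evw (map ff ks).
Proof.
  intros F. unfold Lsum.
  set (b := map (fun k m => binomR m k) ks).
  assert (Lb : length b = length ks) by apply length_map.
  assert (W : Forall (weight rho0) b).
  { apply Forall_map. eapply Forall_impl; [|exact F]. intros; apply weight_binom; auto. }
  rewrite <- (msum_ff (fun is => prodR ks (fun k => INR (fact k)) * prodbinom is ks *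
    pds is (lnF J M N) (pone N)) ks F) by auto.
  rewrite <- Lb.
  rewrite (msum_evw b _ 1 W), (msum_evw b _ (prodR ks (fun k => INR (fact k))) W); try ring;
    intros is _; unfold b; rewrite wprod_binom; ring.
Qed.

Lemma pds_Psi is : Forall (fun i => (1 <= i <= N)%nat) is ->
  pds is (Psi J M N) xone = sumR (blocks is) (fun b => evw (map ff (map snd b))).
Proof.
  (* The domain $|x_i|<\mathrm{sg}$ contains $1^N$ and keeps $|p_m|\le N\rho_0^m$; the gap up to
     [rho0] absorbs the polynomial growth of [ff k m] in the block vectors. *)
  intros Fi. set (sg := (1 + rho0) / 2).
  replace (Psi J M N) with (fun x => ln (F0 cf (pxs N) x)).
  2:{ apply functional_extensionality; intros x. unfold Psi, FxN, F0. rewrite FN_TF; auto. }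
  rewrite (pds_ln cf (INR N) rho0 rho1 Atot INR_N Hr0 Hr1 Hs (nat * nat) blockw (pxs N)
    (fun i => (i, 1%nat)) block_raise (fun i => (1 <= i <= N)%nat)
    (fun x => forall i, Rabs (x i) < sg)); auto.
  - unfold blocks. apply sumR_ext. intros b _. unfold wq, F0. rewrite pxs_one. unfold evw.
    rewrite map_map, <- (ev_cum_map (fun a => ff (snd a))). f_equal.
    apply functional_extensionality; intros T. do 2 f_equal.
    apply map_ext. apply blockw_one.
  - intros x i Hx _. exists (sg - Rabs (x i)). split; [specialize (Hx i); lra|].
    intros t Ht m. unfold upd. destruct (Nat.eqb_spec m i) as [->|]; auto.
    replace t with ((t - x i) + x i) by ring.
    eapply Rle_lt_trans; [apply Rabs_triang|]. lra.
  - intros x Hx m _. unfold pxs. eapply Rle_trans; [apply sumR_abs|].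
    eapply Rle_trans; [apply (sumR_le _ _ (fun _ => rho0 ^ m))|].
    + intros i _. rewrite <- RPow_abs. apply pow_incr. split; [apply Rabs_pos|].
      specialize (Hx i). unfold sg in Hx. lra.
    + rewrite sumR_const, length_seq. lra.
  - intros [i k]. destruct (poly_le_geom k sg rho0) as [C [PC HC]]; [unfold sg; lra|].
    exists C. intros x Hx m. unfold blockw. simpl. rewrite Rabs_mult.
    eapply Rle_trans; [|apply HC]. destruct (ff_pos_bound k m).
    rewrite (Rabs_pos_eq (ff k m)) by auto.
    apply Rmult_le_compat; auto using Rabs_pos.
    rewrite <- RPow_abs. apply Rle_trans with (sg ^ (m - k)).
    + apply pow_incr. split; [apply Rabs_pos | apply Rlt_le; auto].
    + apply Rle_pow; [unfold sg; lra | lia].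
  - intros x i m _ Hi _. apply pxs_deriv; auto.
  - intros x i a m _ _. apply blockw_deriv.
  - intros i. unfold xone. rewrite Rabs_R1. unfold sg. lra.
  - unfold F0. rewrite pxs_one. auto.
Qed.
End Radii.
End Positive.

(** Serves the conditions of orders one and two, which are stated with the factorials inside the
    sum. *)
Lemma msum_fact_binom f ks : pos ks ->
  (forall is, length is = length ks ->
     f is = prodR ks (fun k => INR (fact k)) * prodbinom is ks * pds is (lnF J M N) (pone N)) ->
  msum (length ks) f = Lsum J M N ks.
Proof.
  intros F Hf. destruct FN_dichotomy as [Z|P].
  - rewrite Lsum_zero by auto. rewrite (msum_ext _ _ (fun _ => 0)); [apply msum_zero|].
    intros is Hl. rewrite Hf, lnF_zero, pds_zero by auto. ring.
  - destruct summable as [rho1 [Atot [Hr Hs]]].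
    rewrite (Lsum_evw P ((1 + rho1) / 2) rho1 Atot), (msum_ff P ((1 + rho1) / 2) rho1 Atot); auto; lra.
Qed.

Lemma Psi_derivative is : Forall (fun i => (1 <= i <= N)%nat) is ->
  pds is (Psi J M N) xone = sumR (blocks is) (fun b => Lsum J M N (map snd b)).
Proof.
  intros F. destruct FN_dichotomy as [Z|P].
  - rewrite Psi_zero, pds_zero by auto. symmetry. apply sumR_zero. intros; apply Lsum_zero; auto.
  - destruct summable as [rho1 [Atot [Hr Hs]]].
    rewrite (pds_Psi P ((1 + rho1) / 2) rho1 Atot) by (auto; lra).
    apply sumR_ext. intros b Hb. symmetry. apply (Lsum_evw P ((1 + rho1) / 2) rho1 Atot); auto; try lra.
    apply (blocks_spec is b Hb).
Qed.
End FixedN.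

(** * Limits in N *)

Lemma Un_cv_congr_from n0 u v l : (forall n, (n0 <= n)%nat -> u n = v n) -> (Un_cv u l <-> Un_cv v l).
Proof.
  intros E; split; apply (Un_cv_ext_from n0); auto. intros; symmetry; auto.
Qed.

Lemma Un_cv_scal c u l : Un_cv u l -> Un_cv (fun n => c * u n) (c * l).
Proof.
  intros H. apply (CV_mult (fun _ => c)); auto.
  intros e He; exists 0%nat; intros; rewrite R_dist_eq; auto.
Qed.

Lemma Un_cv_inv_INR_mult u l : Un_cv u l -> Un_cv (fun N => / INR N * u N) 0.
Proof.
  intros H. rewrite <- (Rmult_0_l l). apply (CV_mult (fun N => / INR N)); auto.
  intros e He. destruct (archimed_cor1 e He) as [n0 [H0 H1]]. exists n0. intros n Hn.
  unfold Rdist. rewrite Rminus_0_r.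
  assert (0 < INR n0) by (apply lt_0_INR; auto).
  assert (INR n0 <= INR n) by (apply le_INR; auto).
  rewrite Rabs_pos_eq by (apply Rlt_le, Rinv_0_lt_compat; lra).
  eapply Rle_lt_trans; [|exact H0]. apply Rinv_le_contravar; auto.
Qed.

Lemma spread_two i j k l : spread [(i, k); (j, l)] = repeat i k ++ repeat j l.
Proof. unfold spread. simpl. rewrite app_nil_r; auto. Qed.

Lemma spread_one i k : spread [(i, k)] = repeat i k.
Proof. unfold spread. simpl. rewrite app_nil_r; auto. Qed.

Section Limits.
Variables (J : list nat -> list nat -> R) (M : nat -> list nat -> R).
Hypothesis HM : forall N, IsProbY (M N) N.
Hypothesis HA : AssumptionA J M.

Let X N is := pds is (Psi J M N) xone.
Let L := Lsum J M.

Lemma X_eq is : Forall (fun i => (1 <= i)%nat) is ->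
  exists n0, forall N, (n0 <= N)%nat -> X N is = sumR (blocks is) (fun b => L N (map snd b)).
Proof.
  (* The successor gives $N\ge1$ even for the empty list. *)
  intros F. exists (S (list_max is)). intros N HN. apply Psi_derivative; auto; [lia|].
  assert (Q : (list_max is <= N)%nat) by lia. rewrite list_max_le in Q.
  apply Forall_and; auto.
Qed.

Lemma prod_fact_pos ks : 0 < prodR ks (fun k => INR (fact k)).
Proof. induction ks; simpl; [lra|]. apply Rmult_lt_0_compat; auto. apply INR_fact_lt_0. Qed.

Lemma vanish_from_msum s r :
  vanish_from L s r <->
  (forall ks, (r <= length ks)%nat -> Forall (fun k => (1 <= k)%nat) ks ->
    Un_cv (fun N => s N * msum (length ks) (fun is => prodbinom is ks * pds is (lnF J M N) (pone N))) 0).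
Proof.
  split; intros H ks H1 H2; pose proof (prod_fact_pos ks) as P.
  - rewrite <- (Rmult_0_r (/ prodR ks (fun k => INR (fact k)))).
    eapply (Un_cv_ext_from 0); [|apply Un_cv_scal, (H ks H2 H1)].
    intros N _. unfold L, Lsum. field. lra.
  - rewrite <- (Rmult_0_r (prodR ks (fun k => INR (fact k)))).
    eapply (Un_cv_ext_from 0); [|apply Un_cv_scal, (H ks H2 H1)].
    intros N _. unfold L, Lsum. ring.
Qed.

Lemma AssumptionL1_Lsum cc : AssumptionL1 J M cc <->
  (forall k, (1 <= k)%nat -> Un_cv (fun N => / INR N * L N [k]) (cc k)).
Proof.
  assert (E : forall k, (1 <= k)%nat -> forall N, (1 <= N)%nat ->
    / INR N * Series (fun j => INR (fact k) * binomR (S j) k * pds [S j] (lnF J M N) (pone N)) =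
    / INR N * L N [k]).
  { intros k Hk N HN. f_equal.
    apply (msum_fact_binom J M N HN (HM N) HA
      (fun is => INR (fact k) * binomR (nth 0 is 0%nat) k * pds is (lnF J M N) (pone N)) [k]);
      [repeat constructor; auto|].
    intros [|i [|? ?]] Hl; try discriminate. unfold prodbinom; simpl; ring. }
  split; intros H k Hk; apply (Un_cv_congr_from 1 _ _ (cc k) (E k Hk)), H; auto.
Qed.

Lemma msum_two_Lsum d k l : (1 <= k)%nat -> (1 <= l)%nat ->
  (Un_cv (fun N => msum 2 (fun is => INR (fact k) * INR (fact l) * binomR (nth 0 is 0%nat) k
                         * binomR (nth 1 is 0%nat) l * pds is (lnF J M N) (pone N))) d <->
   Un_cv (fun N => 1 * L N [k; l]) d).
Proof.
  intros Hk Hl. apply (Un_cv_congr_from 1). intros N HN. rewrite Rmult_1_l.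
  apply (msum_fact_binom J M N HN (HM N) HA _ [k; l]); [repeat constructor; auto|].
  intros [|i [|j [|? ?]]] E; try discriminate. unfold prodbinom; simpl; ring.
Qed.

Lemma X_power s c i k : (1 <= i)%nat -> (1 <= k)%nat -> vanish_from L s 2 ->
  (Un_cv (fun N => s N * X N (repeat i k)) c <-> Un_cv (fun N => s N * L N [k]) c).
Proof.
  intros Hi Hk V. rewrite <- spread_one.
  apply (lead_cv X L X_eq s [(i, k)]); repeat constructor; simpl; auto.
Qed.

Lemma X_mixed s c i j k l : (1 <= i)%nat -> (1 <= j)%nat -> i <> j -> (1 <= k)%nat -> (1 <= l)%nat ->
  vanish_from L s 3 ->
  (Un_cv (fun N => s N * X N (repeat i k ++ repeat j l)) c <-> Un_cv (fun N => s N * L N [k; l]) c).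
Proof.
  intros Hi Hj Hij Hk Hl V. rewrite <- spread_two.
  apply (lead_cv X L X_eq s [(i, k); (j, l)]); repeat constructor; simpl; auto.
  intros [E|[]]; congruence.
Qed.

Lemma CondX1_Lsum cc : vanish_from L (fun N => / INR N) 2 ->
  (CondX1 J M cc <-> (forall k, (1 <= k)%nat -> Un_cv (fun N => / INR N * L N [k]) (cc k))).
Proof.
  intros V. split.
  - intros H k Hk. apply (X_power (fun N => / INR N) (cc k) 1 k); auto. apply H; auto.
  - intros H i k Hi Hk. apply (X_power (fun N => / INR N) (cc k) i k); auto.
Qed.

Lemma CondL2_Lsum : vanish_from L (fun N => / INR N) 2 <->
  (forall is : list nat, (2 <= length is)%nat -> Forall (fun i => (1 <= i)%nat) is ->
    (exists a b, In a is /\ In b is /\ a <> b) ->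
    Un_cv (fun N => / INR N * pds is (Psi J M N) xone) 0).
Proof.
  split.
  - intros V is _ F [a [b [Ha [Hb Hab]]]].
    apply (vanish_deriv X L X_eq (fun N => / INR N) 2 [a; b] is V F); auto.
    + repeat constructor; simpl; intuition.
    + intros x [<-|[<-|[]]]; auto.
  - intros H. apply (vanish_from_deriv X L X_eq). intros is D F ND I Hl.
    destruct D as [|a [|b [|? ?]]]; try discriminate.
    apply H; auto.
    + apply (NoDup_incl_length ND I).
    + exists a, b. inversion ND; subst. simpl in *. repeat split; try (apply I; simpl; auto); intuition.
Qed.

Lemma CondC3_Lsum : vanish_from L (fun _ => 1) 3 <->
  (forall is : list nat, (3 <= length is)%nat -> Forall (fun i => (1 <= i)%nat) is ->
    (exists a b e, In a is /\ In b is /\ In e is /\ a <> b /\ a <> e /\ b <> e) ->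
    Un_cv (fun N => pds is (Psi J M N) xone) 0).
Proof.
  split.
  - intros V is _ F [a [b [e [Ha [Hb [He [H1 [H2 H3]]]]]]]].
    apply (Un_cv_ext_from 0 (fun N => 1 * X N is)); [intros; apply Rmult_1_l|].
    apply (vanish_deriv X L X_eq (fun _ => 1) 3 [a; b; e] is V F); auto.
    + repeat constructor; simpl; intuition.
    + intros x [<-|[<-|[<-|[]]]]; auto.
  - intros H. apply (vanish_from_deriv X L X_eq). intros is D F ND I Hl.
    destruct D as [|a [|b [|e [|? ?]]]]; try discriminate.
    apply (Un_cv_ext_from 0 (fun N => X N is)); [intros; symmetry; apply Rmult_1_l|].
    apply H; auto.
    + apply (NoDup_incl_length ND I).
    + exists a, b, e. inversion ND as [|? ? N1 ND1]; subst. inversion ND1; subst. simpl in *.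
      repeat split; try (apply I; simpl; auto); intuition.
Qed.

Lemma CondC2_Lsum (d : nat -> nat -> R) : vanish_from L (fun _ => 1) 3 ->
  ((forall i j k l, (1 <= i)%nat -> (1 <= j)%nat -> i <> j -> (1 <= k)%nat -> (1 <= l)%nat ->
    Un_cv (fun N => pds (repeat i k ++ repeat j l) (Psi J M N) xone) (d k l)) <->
   (forall k l, (1 <= k)%nat -> (1 <= l)%nat -> Un_cv (fun N => 1 * L N [k; l]) (d k l))).
Proof.
  intros V. split.
  - intros H k l Hk Hl. apply (X_mixed (fun _ => 1) (d k l) 1 2 k l); auto.
    apply (Un_cv_ext_from 0 (fun N => X N (repeat 1%nat k ++ repeat 2%nat l))); [intros; symmetry; apply Rmult_1_l|].
    apply H; auto.
  - intros H i j k l Hi Hj Hij Hk Hl.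
    apply (Un_cv_ext_from 0 (fun N => 1 * X N (repeat i k ++ repeat j l))); [intros; apply Rmult_1_l|].
    apply (X_mixed (fun _ => 1) (d k l) i j k l); auto.
Qed.

(** Unscaled limits are finite from order two on, so division by $N$ kills them. This lets the
    single-index limits in (b) be treated as in (a). *)
Lemma vanish_from_three (d : nat -> nat -> R) : vanish_from L (fun _ => 1) 3 ->
  (forall k l, (1 <= k)%nat -> (1 <= l)%nat -> Un_cv (fun N => 1 * L N [k; l]) (d k l)) ->
  vanish_from L (fun N => / INR N) 2.
Proof.
  intros V H ks P Hr.
  apply (Un_cv_ext_from 0 (fun N => / INR N * (1 * L N ks))); [intros; rewrite Rmult_1_l; auto|].
  destruct (le_lt_dec 3 (length ks)) as [H3|H3].
  - apply (Un_cv_inv_INR_mult _ 0). apply V; auto.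
  - destruct ks as [|k [|l [|? ?]]]; simpl in *; try lia.
    inversion P as [|? ? Hk P']; subst. inversion P' as [|? ? Hl P'']; subst.
    apply (Un_cv_inv_INR_mult _ (d k l)). apply H; auto.
Qed.

Lemma AssumptionL_iff cc : AssumptionL J M cc <-> CondLx J M cc.
Proof.
  unfold AssumptionL, CondLx.
  rewrite <- (vanish_from_msum (fun N => / INR N) 2), <- CondL2_Lsum, AssumptionL1_Lsum.
  split; intros [H V]; split; auto; apply CondX1_Lsum; auto.
Qed.

Lemma AssumptionC_iff cc d : AssumptionC J M cc d <-> CondCx J M cc d.
Proof.
  assert (E2 : (forall k l, (1 <= k)%nat -> (1 <= l)%nat ->
      Un_cv (fun N => msum 2 (fun is => INR (fact k) * INR (fact l) * binomR (nth 0 is 0%nat) k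
                         * binomR (nth 1 is 0%nat) l * pds is (lnF J M N) (pone N))) (d k l)) <->
    (forall k l, (1 <= k)%nat -> (1 <= l)%nat -> Un_cv (fun N => 1 * L N [k; l]) (d k l))).
  { split; intros H k l Hk Hl; apply (msum_two_Lsum (d k l) k l Hk Hl); auto. }
  assert (E3 : (forall ks : list nat, (3 <= length ks)%nat -> Forall (fun k => (1 <= k)%nat) ks ->
      Un_cv (fun N => msum (length ks) (fun is => prodbinom is ks * pds is (lnF J M N) (pone N))) 0) <->
    vanish_from L (fun _ => 1) 3).
  { rewrite vanish_from_msum. split; intros H ks H1 H2; generalize (H ks H1 H2);
      apply (Un_cv_congr_from 0); intros; ring. }
  unfold AssumptionC, CondCx. rewrite E2, E3, <- CondC3_Lsum, AssumptionL1_Lsum.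
  split; intros [H [H2 V]].
  - assert (V2 := vanish_from_three d V H2).
    repeat split; auto; [apply CondX1_Lsum | apply CondC2_Lsum]; auto.
  (* The order is forced: vanishing from order three gives the mixed limits, these give vanishing
     from order two after division by $N$, and only then are the first-order limits accessible. *)
  - assert (H2' := proj1 (CondC2_Lsum d V) H2). assert (V2 := vanish_from_three d V H2').
    repeat split; auto. apply CondX1_Lsum; auto.
Qed.
End Limits.

Theorem theoremB1 (theta : R) (J : list nat -> list nat -> R) (M : nat -> list nat -> R) :
  0 < theta ->
  IsJack theta J ->
  (forall N : nat, IsProbY (M N) N) ->
  AssumptionA J M ->
  (forall cc : nat -> R, AssumptionL J M cc <-> CondLx J M cc) /\
  (forall (cc : nat -> R) (d : nat -> nat -> R), AssumptionC J M cc d <-> CondCx J M cc d).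
Proof.
  intros _ _ HM HA. split.
  - intros cc. apply AssumptionL_iff; auto.
  - intros cc d. apply AssumptionC_iff; auto.
Qed.
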